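(* Let $m\ge 2$ be an integer and let $I=B(u_1,\ldots,u_m)\subset S$ be a Borel ideal with Borel generators $u_1,\ldots,u_m$ of degree $2$, where $u_k=x_{i_k}x_{j_k}$ with $1\le i_k\le j_k\le n$ for $1\le k\le m$, and where $m$ is the minimum number of Borel generators of $I$. Then $I$ is Freiman if and only if either $I=B(x_1x_{j_1},x_2x_{j_2})$ for some integers $2\le j_2<j_1\le n$, or $I=B(x_1x_{j_1},x_3^2)$ for some integer $3<j_1\le n$.
   Context: Throughout, $n\ge 3$ is an integer, $K$ is a field, $S=K[x_1,\ldots,x_n]$ is the polynomial ring and $\mathfrak m=(x_1,\ldots,x_n)$. For a monomial ideal $I\subset S$, $G(I)$ is its unique minimal set of monomial generators and $\mu(I)=|G(I)|$. $I$ is equigenerated if all elements of $G(I)$ have the same degree. The analytic spread $\ell(I)$ is the Krull dimension of the fiber ring $F(I)=\bigoplus_{k\ge 0}I^k/\mathfrak m I^k$. An equigenerated monomial ideal $I$ is called Freiman if $\mu(I^2)=\ell(I)\mu(I)-\binom{\ell(I)}{2}$. For a monomial $u$, $\mathrm{supp}(u)=\{i: x_i\mid u\}$. A monomial ideal $I$ is Borel if for every $u\in G(I)$, every $j\in\mathrm{supp}(u)$ and every $i<j$ one has $x_i(u/x_j)\in I$. For monomials $u_1,\ldots,u_m$, $B(u_1,\ldots,u_m)$ denotes the unique smallest (with respect to inclusion) Borel ideal containing $u_1,\ldots,u_m$, and $u_1,\ldots,u_m$ are called Borel generators of it. The minimum number of Borel generators of a Borel ideal $I$ is the least $r$ such that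 $I=B(v_1,\ldots,v_r)$ for some monomials $v_1,\ldots,v_r$. *)

(* Defs.v *)
From HB Require Import structures.
From mathcomp Require Import all_boot all_order all_algebra.
From mathcomp Require Import ring_quotient.
From mathcomp Require Import boolp classical_sets functions cardinality.
From mathcomp Require Import finmap mpoly.

Set Implicit Arguments.
Unset Strict Implicit.
Unset Printing Implicit Defensive.

Import Order.TTheory GRing.Theory Num.Theory.

Local Open Scope classical_set_scope.
Local Open Scope ring_scope.

Section Ideals.
Variable R : comNzRingType.
Implicit Types (I J A P : set R).

Definition ideal I :=
  [/\ I 0, forall x y, I x -> I y -> I (x + y)
    & forall a x, I x -> I (a * x)].

Definition ideal_gen A : set R := smallest ideal A.

Definition ideal_mul I J : set R :=
  ideal_gen [set z | exists x y, [/\ I x, J y & z = x * y]].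

(* The zeroth power is the whole ring. *)
Definition ideal_pow I (k : nat) : set R := iter k (ideal_mul I) setT.

Definition prime_ideal P :=
  [/\ ideal P, ~ P 1 & forall x y, P (x * y) -> P x \/ P y].

Definition prime_chain (P : nat -> set R) (d : nat) :=
  (forall k, (k <= d)%N -> prime_ideal (P k)) /\
  (forall k, (k < d)%N -> P k `<` P k.+1).

Lemma ideal_gen_ideal A : ideal (ideal_gen A).
Proof.
split=> [J [[]]//|x y Ix Iy J JA|a x Ix J JA]; have [[_ D M] _] := JA.
  by apply: D; [apply: Ix|apply: Iy].
by apply: M; apply: Ix.
Qed.

Lemma ideal_gen_sub A : A `<=` ideal_gen A.
Proof. by move=> x Ax J [_]; apply. Qed.

Lemma ideal_gen_min A J : ideal J -> A `<=` J -> ideal_gen A `<=` J.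
Proof. by move=> iJ AJ x; apply. Qed.

Lemma ideal_pow_ideal I k : ideal (ideal_pow I k).
Proof. by case: k => [|k]; [split|exact: ideal_gen_ideal]. Qed.

Lemma ideal_sum I (T : Type) (r : seq T) (Q : pred T) (F : T -> R) :
  ideal I -> (forall t, Q t -> I (F t)) -> I (\sum_(t <- r | Q t) F t).
Proof. by move=> [I0 ID _] IF; apply: (big_ind I). Qed.

Lemma ideal_mulMl A J K L x y : ideal K -> ideal L ->
  (forall a b, A a -> J b -> K y -> L (a * b * y)) ->
  ideal_mul A J x -> K y -> L (x * y).
Proof.
move=> iK [L0 LD LM] H Hx Ky.
apply: (Hx (fun x => L (x * y))); split.
  split=> [|u v Lu Lv|a u Lu]; first by rewrite mul0r.
    by rewrite mulrDl; apply: LD.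
  by rewrite -mulrA; apply: LM.
by move=> _ [a [b [Aa Jb ->]]]; apply: H.
Qed.

Lemma ideal_powD I i j x y :
  ideal_pow I i x -> ideal_pow I j y -> ideal_pow I (i + j) (x * y).
Proof.
elim: i x => [|i IHi] x Hx Hy.
  by have [_ _ M] := ideal_pow_ideal I j; apply: M.
apply: ideal_mulMl Hx Hy; [exact: ideal_pow_ideal..|].
move=> a b Ia Ib Hy; rewrite -mulrA addSn; apply: ideal_gen_sub.
by exists a, (b * y); split=> //; apply: IHi.
Qed.

Lemma ideal_mul_powD M I i j x y :
  ideal_pow I i x -> ideal_mul M (ideal_pow I j) y ->
  ideal_mul M (ideal_pow I (i + j)) (x * y).
Proof.
rewrite mulrC addnC => Hx Hy.
apply: ideal_mulMl Hy Hx; [exact: ideal_pow_ideal|exact: ideal_gen_ideal|].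
move=> a b Ma Ib Hx; rewrite -mulrA; apply: ideal_gen_sub.
by exists a, (b * x); split=> //; apply: ideal_powD.
Qed.

End Ideals.

(* The supremum of the lengths of chains of primes is attained and equals d. *)
Definition krull_dim (R : comNzRingType) (d : nat) :=
  (exists P : nat -> set R, prime_chain P d) /\
  (forall (P : nat -> set R) e, prime_chain P e -> (e <= d)%N).

Section FiberRing.
Variables (K : fieldType) (n : nat).
Local Notation S := {mpoly K[n]}.
Implicit Types (I : set S).

Definition max_ideal : set S := ideal_gen (range (fun i : 'I_n => 'X_i : S)).

(* The Rees algebra \bigoplus_k I^k, realized as the subring of the polynomial
   ring S[t] whose elements have their t^k-coefficient in I^k. *)
Definition rees_pred I : {pred {poly S}} :=
  fun p => `[< forall k, ideal_pow I k p`_k >].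

Lemma rees_subring I : subring_closed (rees_pred I).
Proof.
split.
- apply/asboolP=> k; rewrite coef1; case: k => [|k] //.
  by have [] := ideal_pow_ideal I k.+1.
- move=> p q /asboolP Hp /asboolP Hq; apply/asboolP=> k.
  have [_ D M] := ideal_pow_ideal I k.
  by rewrite coefB -mulN1r; apply: D; [exact: Hp|apply: M; exact: Hq].
- move=> p q /asboolP Hp /asboolP Hq; apply/asboolP=> k.
  rewrite coefM; apply: ideal_sum; first exact: ideal_pow_ideal.
  move=> [i /=]; rewrite ltnS => ik _; rewrite -{1}(subnKC ik).
  exact: ideal_powD.
Qed.

HB.instance Definition _ I :=
  GRing.isSubringClosed.Build {poly S} (rees_pred I) (rees_subring I).

Record rees I := Rees { rees_val : {poly S}; _ : rees_val \in rees_pred I }.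

HB.instance Definition _ I := [isSub of rees I for @rees_val I].
HB.instance Definition _ I := [Choice of rees I by <:].
HB.instance Definition _ I := [SubChoice_isSubComNzRing of rees I by <:].

Definition fiber_pred I : {pred rees I} := fun p =>
  `[< forall k, ideal_mul max_ideal (ideal_pow I k) (rees_val p)`_k >].

Lemma max_ideal_mcoeff0 J p : ideal_mul max_ideal J p -> p@_0%MM = 0.
Proof.
have iZ : ideal [set p : S | p@_0%MM = 0].
  split=> /= [|x y x0 y0|a x x0]; first by rewrite mcoeff0.
    by rewrite mcoeffD x0 y0 addr0.
  by have := rmorphM (mcoeff 0%MM : S -> K) a x; rewrite /= x0 mulr0.
move: p; apply: (ideal_gen_min iZ) => _ [x [y [Mx _ ->]]] /=.
have [_ _ M] := iZ; rewrite mulrC; apply: (M y x).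
move: x Mx; apply: (ideal_gen_min iZ) => _ [i _ <-] /=.
by rewrite mcoeffX mnm1_eq0.
Qed.

Lemma fiber_idealr I : idealr_closed (@fiber_pred I).
Proof.
have iM k : ideal (ideal_mul max_ideal (ideal_pow I k)).
  exact: ideal_gen_ideal.
split.
- by apply/asboolP=> k /=; rewrite coef0; have [] := iM k.
- apply/negP=> /asboolP /(_ 0)/max_ideal_mcoeff0 /=; rewrite coef1 mcoeff1 eqxx.
  by move/eqP; rewrite oner_eq0.
- move=> [a aI] p q /asboolP Hp /asboolP Hq; apply/asboolP=> k /=.
  rewrite coefD coefM; have [_ D _] := iM k; apply: D; last exact: Hq.
  apply: ideal_sum => // -[i /=]; rewrite ltnS => ik _; rewrite -{1}(subnKC ik).
  by apply: ideal_mul_powD; [move/asboolP: aI|].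
Qed.

HB.instance Definition _ I :=
  isIdealr.Build (rees I) (@fiber_pred I) (@fiber_idealr I).

(* \bigoplus_k I^k / m I^k *)
Definition fiber_ring I : comNzRingType := {ideal_quot (@fiber_pred I)}.

Definition analytic_spread I (l : nat) := krull_dim (fiber_ring I) l.

End FiberRing.

Section MonomialIdeals.
Variables (K : fieldType) (n : nat).
Local Notation S := {mpoly K[n]}.
Implicit Types (I : set S) (A : set 'X_{1..n}).

Definition monomials A : set S := [set 'X_[u] | u in A].

Definition monomial_ideal I := exists A, I = ideal_gen (monomials A).

Definition minimal_gens I A :=
  I = ideal_gen (monomials A) /\
  forall A', A' `<=` A -> I = ideal_gen (monomials A') -> A' = A.

(* Exponent vectors of the elements of G(I). *)
Definition mingens I : set 'X_{1..n} := xget set0 (minimal_gens I).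

(* [fset_set] sends infinite sets to the empty one; by Dickson's lemma [mingens I]
   is always finite. *)
Definition mu I : nat := #|` fset_set (mingens I)|.

Definition equigenerated I := exists d, forall u, mingens I u -> mdeg u = d.

Definition freiman I :=
  [/\ monomial_ideal I, equigenerated I
    & exists2 l, analytic_spread I l
      & (mu (ideal_pow I 2))%:Z = l%:Z * (mu I)%:Z - 'C(l, 2)%:Z].

Definition borel I :=
  monomial_ideal I /\
  forall u, mingens I u -> forall i j : 'I_n, u j != 0%N -> (i < j)%N ->
    I 'X_[(U_(i) + (u - U_(j)))%MM].

Definition borel_span (us : seq 'X_{1..n}) : set S :=
  smallest borel (monomials [set` us]).

Definition min_borel_gens I (r : nat) :=
  (exists2 vs, size vs = r & I = borel_span vs) /\
  (forall vs, I = borel_span vs -> (r <= size vs)%N).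

End MonomialIdeals.

Arguments borel_span K {n} us.

(* Exponent vector of the variable x_k, numbered from 1 (the ordinals of 'I_n
   start at 0); meaningful for 1 <= k <= n. *)
Definition xvar (n k : nat) : 'X_{1..n} :=
  [multinom nat_of_bool (k == i.+1) | i < n].

(* Main.v *)
Require Import Defs.
From HB Require Import structures.
From mathcomp Require Import all_boot all_order all_algebra.
From mathcomp Require Import generic_quotient.
From mathcomp Require Import boolp classical_sets cardinality.
From mathcomp Require Import finmap mpoly.
From mathcomp Require Import zify.

Set Implicit Arguments.
Unset Strict Implicit.
Unset Printing Implicit Defensive.

Import GRing.Theory.

(** Being generated by monomials of one degree [delta] makes the fiber ring
of [I] concrete: keeping, of an element of [I^k], only the part of degree
[delta * k] kills exactly [m I^k], so the fiber ring is the subring of [S]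
spanned by the products of elements of [G(I)] (lemma [fiber_ring_embedding]).
Let [delta = 2], let [I] be Borel and let [x_d] be the last variable that
occurs in [G(I)].  Then [x_1 x_1, ..., x_1 x_d] lie in [I], so the primes
[(x_{d-k+1}, ..., x_d)] of [S] stay distinct when contracted to the fiber ring
and form a chain of length [d].  No chain is longer, because any [d + 1]
polynomials in [d] variables are algebraically dependent.  Hence the analytic
spread is [d] (lemma [analytic_spread_quadric]), and with [G = G(I)] written
additively the Freiman condition is the equation
[|G + G| + 'C(d, 2) = d |G|].

A Borel set of quadratic monomials is a staircase: a first row
[x_1 x_1, ..., x_1 x_d] and a Borel set [B] in [x_2, ..., x_d].  Sorting sums
by their exponent in [x_1] gives
[|G + G| = 'C(d + 1, 2) + |V + B| + |B + B|] with [V = {x_2, ..., x_d}].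
Let [x_2 x_2, ..., x_2 x_e] be the first row of [B] and [C] the rest.  One more
such step makes all binomials cancel, and the Freiman condition becomes
[2 |W + C| + |C + C| = e |C|] with [W = {x_3, ..., x_e}], an equation in which
[d] no longer occurs (lemma [card_freiman_two_rows]).  Induction on the rows
shows that the left side is never smaller than the right side, and is larger
as soon as [C] is nonempty and [W] has two elements (lemma
[shifted_surplus]).  So [C] is empty, or [e = 3] and [C = {x_3^2}]: this is
[card_freiman_shifted].

The remaining staircases are generated by [x_1 x_d], by [x_1 x_d, x_2 x_e] or by
[x_1 x_d, x_3^2].  Those generated by one monomial ([B] empty, [d = e], and
[d = 3] in the last case) are ruled out by the hypothesis that at least
two Borel generators are needed. *)

(** * Sumsets of staircases of quadratic monomials *)

Section Shifted.
Variable n : nat.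
Local Notation T := 'X_{1..n}.
Local Notation x := (xvar n).
Local Open Scope fset_scope.
Implicit Types (A B : {fset T}) (u v : T).

Definition msum A B : {fset T} := [fset (u + v)%MM | u in A, v in B].
Definition translate v A : {fset T} := [fset (v + u)%MM | u in A].
(** Half-open, like the lists of [iota]: [x q] is excluded. *)
Definition vars s q : {fset T} := [fset x k | k in iota s (q - s)].

Lemma msumP A B w :
  reflect (exists u v, [/\ u \in A, v \in B & w = (u + v)%MM]) (w \in msum A B).
Proof.
apply: (iffP (imfset2P _ _ _ _ _)) => [[u Au [v Bv ->]]|[u [v [Au Bv ->]]]].
  by exists u, v.
by exists u => //; exists v.
Qed.

Lemma mem_msum A B u v : u \in A -> v \in B -> (u + v)%MM \in msum A B.
Proof. by move=> Au Bv; apply/msumP; exists u, v. Qed.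

Lemma translateP v A w :
  reflect (exists2 u, u \in A & w = (v + u)%MM) (w \in translate v A).
Proof. by apply: (iffP (imfsetP _ _ _ _)) => [[u]|[u]]; exists u. Qed.

Lemma card_translate v A : #|` translate v A| = #|` A|.
Proof. by rewrite card_imfset //; apply: addmI. Qed.

(** Every count below splits a set of monomials by the exponent of one variable;
this is the additivity that such a split gives. *)
Lemma card_fsetU_deg (o : 'I_n) c A B :
  {in A, forall u, (c <= u o)%N} -> {in B, forall u, (u o < c)%N} ->
  #|` A `|` B| = (#|` A| + #|` B|)%N.
Proof.
move=> Ac Bc; rewrite -cardfsUI [X in (_ + X)%N](_ : _ = 0) ?addn0 //.
apply/eqP; rewrite cardfs_eq0 -fsubset0; apply/fsubsetP => u.
by rewrite inE => /andP[/Ac + /Bc]; rewrite ltnNge => ->.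
Qed.

Lemma varsP s q u :
  reflect (exists2 k, (s <= k < q)%N & u = x k) (u \in vars s q).
Proof.
by apply: (iffP (imfsetP _ _ _ _)) => -[k Hk ->]; exists k => //; move: Hk;
  rewrite /= mem_iota; lia.
Qed.

Lemma mem_vars s q k : (s <= k < q)%N -> x k \in vars s q.
Proof. by move=> Hk; apply/varsP; exists k. Qed.

Lemma vars_widen s q s' q' u :
  (s' <= s)%N -> (q <= q')%N -> u \in vars s q -> u \in vars s' q'.
Proof. by move=> ? ? /varsP[k ? ->]; apply: mem_vars; lia. Qed.

Lemma xvarE k (o : 'I_n) : x k o = (k == o.+1) :> nat.
Proof. by rewrite mnmE. Qed.

Lemma var_ord s : (0 < s <= n)%N -> exists o : 'I_n, s = o.+1.
Proof.
move=> Hs; have lt_sn : (s.-1 < n)%N by lia.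
by exists (Ordinal lt_sn) => /=; lia.
Qed.

Lemma vars_deg0 s q (o : 'I_n) u :
  (o.+1 < s)%N || (q <= o.+1)%N -> u \in vars s q -> u o = 0.
Proof. by move=> Ho /varsP[k Hk ->]; rewrite xvarE; lia. Qed.

Lemma card_vars s q : (0 < s)%N -> (q <= n.+1)%N -> #|` vars s q| = (q - s)%N.
Proof.
move=> s0 qn; rewrite card_in_imfset /=.
  by rewrite undup_id ?iota_uniq // size_iota.
move=> k l /=; rewrite !mem_iota => Hk Hl kl.
have [|o ko] := @var_ord k; first lia.
by have := xvarE l o; rewrite -kl xvarE -ko eqxx; lia.
Qed.


(** [shifted s q A]: the set [A] of quadratic monomials in [x_s, ..., x_{q-1}]
is Borel. Its rows are initial segments of decreasing length; the bound [p] on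
the first row is passed on to the remaining rows, so that an induction on this
predicate peels off one row, and one variable, at a time. *)
Inductive shifted : nat -> nat -> {fset T} -> Prop :=
| shifted_nil s q : shifted s q fset0
| shifted_row s p q B : (s < p <= q)%N -> shifted s.+1 p B ->
    shifted s q (translate (x s) (vars s p) `|` B).

Lemma shifted_sub s q A : shifted s q A -> A `<=` msum (vars s q) (vars s q).
Proof.
elim=> [{}s {}q|{}s p {}q B spq _ IH]; apply/fsubsetP => u; rewrite ?inE //.
case/orP=> [/translateP[v Hv ->]|/(fsubsetP IH)/msumP[v [w [Hv Hw ->]]]].
  by apply: mem_msum; [apply: mem_vars; lia|apply: vars_widen Hv; lia].
by apply: mem_msum; [apply: vars_widen Hv; lia|apply: vars_widen Hw; lia].
Qed.

Lemma msum_deg0 A B (o : 'I_n) :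
  {in A, forall u, u o = 0} -> {in B, forall u, u o = 0} ->
  {in msum A B, forall u, u o = 0}.
Proof. by move=> HA HB _ /msumP[u [v [/HA Hu /HB Hv ->]]];
  rewrite mnmDE Hu Hv. Qed.

Lemma shifted_deg0 s q A (o : 'I_n) :
  (o.+1 < s)%N || (q <= o.+1)%N -> shifted s q A -> {in A, forall u, u o = 0}.
Proof.
move=> Ho /shifted_sub/fsubsetP AW u /AW.
by move: u; apply: msum_deg0 => u; apply: vars_deg0.
Qed.

(** The products [x_i x_j] with [s <= i < p] and [s <= j < q], counted by their
smallest variable. Twice the cardinal is used to avoid halving. *)
Lemma card_msum_vars s p q : (0 < s)%N -> (s <= p <= q)%N -> (q <= n.+1)%N ->
  (#|` msum (vars s p) (vars s q)| * 2 =
    (p - s) * (2 * (q - s) + 1 - (p - s)))%N.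
Proof.
move=> s0 /andP[sp pq] qn; move Ed: (p - s)%N => d.
elim: d s s0 sp Ed => [|d IH] s s0 sp Ed.
  rewrite mul0n; apply/eqP; rewrite muln_eq0 orbF cardfs_eq0 -fsubset0.
  by apply/fsubsetP => u /msumP[v [w [/varsP[k Hk _] _ _]]]; lia.
have -> : msum (vars s p) (vars s q) =
    translate (x s) (vars s q) `|` msum (vars s.+1 p) (vars s.+1 q).
  apply/fsetP => w; rewrite inE;
    apply/msumP/orP => [[_ [_ [/varsP[i Hi ->] /varsP[j Hj ->] ->]]]|].
    have [->|i_s] := eqVneq i s.
      by left; apply/translateP; exists (x j) => //; apply: mem_vars.
    have [->|j_s] := eqVneq j s.
      by left; apply/translateP; exists (x i); [apply: mem_vars;
        lia|rewrite addmC].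
    by right; apply: mem_msum; apply: mem_vars; lia.
  case=> [/translateP[u Hu ->]|/msumP[u [v [Hu Hv ->]]]].
    by exists (x s), u; split=> //; apply: mem_vars; lia.
  by exists u, v; split=> //; [apply: vars_widen Hu|apply: vars_widen Hv].
have [|o so] := @var_ord s; first lia.
rewrite (@card_fsetU_deg o 1).
- rewrite card_translate card_vars // mulnDl IH //; try lia.
  have -> : (2 * (q - s) + 1 - d.+1 = (2 * (q - s.+1) + 1 - d).+1)%N by lia.
  rewrite mulSn mulnS; lia.
- by move=> _ /translateP[u _ ->]; rewrite mnmDE xvarE so eqxx.
- move=> u; rewrite ltnS leqn0 => Hu; apply/eqP; move: u Hu.
  by apply: msum_deg0 => u; apply: vars_deg0; rewrite so ltnSn.
Qed.

(** The variables [x_p, ..., x_{q-1}] do not occur in [A], so each of them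
contributes a disjoint translate of [A]. *)
Lemma card_vars_msum s p q A : (0 < s)%N -> (s <= p <= q)%N -> (q <= n.+1)%N ->
  shifted s p A ->
  #|` msum (vars s q) A| = (#|` msum (vars s p) A| + (q - p) * #|` A|)%N.
Proof.
move=> s0 /andP[sp pq] qn sA; move Ed: (q - p)%N => d.
elim: d q pq qn Ed => [|d IH] q pq qn Ed.
  by rewrite mul0n addn0; congr (#|` msum (vars _ _) _|); lia.
have [|o qo] := @var_ord q.-1; first lia.
have -> : msum (vars s q) A = translate (x q.-1) A `|` msum (vars s q.-1) A.
  apply/fsetP => w; rewrite inE;
    apply/msumP/orP => [[_ [v [/varsP[i Hi ->] Hv ->]]]|].
    have [->|i_q] := eqVneq i q.-1; first by left; apply/translateP; exists v.
    by right; apply: mem_msum => //; apply: mem_vars; lia.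
  case=> [/translateP[u Hu ->]|/msumP[u [v [Hu Hv ->]]]].
    by exists (x q.-1), u; split=> //; apply: mem_vars; lia.
  by exists u, v; split=> //; apply: vars_widen Hu; lia.
rewrite (@card_fsetU_deg o 1).
- rewrite card_translate IH //; lia.
- by move=> _ /translateP[u _ ->]; rewrite mnmDE xvarE qo eqxx.
- move=> u; rewrite ltnS leqn0 => Hu; apply/eqP; move: u Hu.
  apply: msum_deg0; last by apply: shifted_deg0 sA; lia.
  by move=> u; apply: vars_deg0; lia.
Qed.

Section Row.
Variables (s p : nat) (B : {fset T}).
Hypotheses (s0 : (0 < s)%N) (sp : (s < p)%N) (sB : shifted s.+1 p B).
Let A := translate (x s) (vars s p) `|` B.

Let B_sub u : u \in B -> exists v w, [/\ v \in vars s.+1 p, w \in vars s.+1 p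
  & u = (v + w)%MM].
Proof. by move=> /(fsubsetP (shifted_sub sB))/msumP. Qed.

Lemma card_row : (p <= n.+1)%N -> #|` A| = (p - s + #|` B|)%N.
Proof.
move=> pn; have [|o so] := @var_ord s; first lia.
rewrite (@card_fsetU_deg o 1) ?card_translate ?card_vars //.
- by move=> _ /translateP[u _ ->]; rewrite mnmDE xvarE so eqxx.
- move=> u Hu; rewrite (shifted_deg0 _ sB) //; lia.
Qed.

(** The sums divisible by [x_s] are all the [x_s x_i x_j] with [x_s x_i] in the
row and [x_j] arbitrary: multiplying [B] by [x_s] gives nothing new, since every
element of [B] is a product of two variables of the row. The other sums come
from [B] and the variables after [x_s]. *)
Lemma card_vars_row q : (p <= q <= n.+1)%N ->
  #|` msum (vars s q) A| =
  (#|` msum (vars s p) (vars s q)| + #|` msum (vars s.+1 q) B|)%N.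
Proof.
move=> /andP[pq qn]; have [|o so] := @var_ord s; first lia.
have -> : msum (vars s q) A =
    translate (x s) (msum (vars s p) (vars s q)) `|` msum (vars s.+1 q) B.
  apply/fsetP => w; rewrite inE;
    apply/msumP/orP => [[_ [v [/varsP[i Hi ->] Hv ->]]]|].
    move: Hv; rewrite inE => /orP[/translateP[u Hu ->]|Bv].
      left; apply/translateP; exists (u + x i)%MM; last by apply/mnmP => k;
        rewrite !mnmDE; lia.
      by apply: mem_msum => //; apply: mem_vars.
    have [->|i_s] := eqVneq i s.
      left; apply/translateP; exists v => //.
      have [u [t [Hu Ht ->]]] := B_sub Bv.
      by apply: mem_msum; [apply: vars_widen Hu|apply: vars_widen Ht].
    by right; apply: mem_msum => //; apply: mem_vars; lia.
  case=> [/translateP[_ /msumP[u [v [Hu Hv ->]]] ->]|/msumP[u [v [Hu Hv ->]]]].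
    exists v, (x s + u)%MM; split; rewrite ?inE //; last by rewrite addmA addmC.
    by apply/orP; left; apply/translateP; exists u.
  by exists u, v; split; rewrite ?inE ?Hv ?orbT //; apply: vars_widen Hu.
rewrite (@card_fsetU_deg o 1) ?card_translate //.
- by move=> _ /translateP[u _ ->]; rewrite mnmDE xvarE so eqxx.
- move=> u; rewrite ltnS leqn0 => Hu; apply/eqP; move: u Hu.
  apply: msum_deg0; last by apply: shifted_deg0 sB; lia.
  by move=> u; apply: vars_deg0; lia.
Qed.

(** The sums are sorted by their exponent in [x_s], which is at least 2, 1 or 0.
Products of [x_s^2] with [B] are already products of two elements of the row. *)
Lemma card_row_row : (p <= n.+1)%N ->
  #|` msum A A| = (#|` msum (vars s p) (vars s p)|
    + (#|` msum (vars s.+1 p) B| + #|` msum B B|))%N.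
Proof.
move=> pn; have [|o so] := @var_ord s; first lia.
have B0 : {in B, forall u, u o = 0} by apply: shifted_deg0 sB; lia.
have V0 : {in vars s.+1 p, forall u, u o = 0} by move=> u; apply: vars_deg0;
  lia.
have BW u : u \in B -> u \in msum (vars s p) (vars s p).
  move=> Bu; have [v [w [Hv Hw ->]]] := B_sub Bu.
  by apply: mem_msum; [apply: vars_widen Hv|apply: vars_widen Hw].
have -> : msum A A =
    translate (x s + x s)%MM (msum (vars s p) (vars s p)) `|`
    (translate (x s) (msum (vars s.+1 p) B) `|` msum B B).
  have mixed u v : u \in vars s p -> v \in B -> (x s + u + v)%MM \in
      translate (x s + x s)%MM (msum (vars s p) (vars s p)) `|`
      (translate (x s) (msum (vars s.+1 p) B) `|` msum B B).
    move=> /varsP[i Hi ->] Bv; rewrite !inE.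
    have [->|i_s] := eqVneq i s.
      by apply/orP; left; apply/translateP; exists v; rewrite ?BW.
    apply/orP; right; apply/orP; left; apply/translateP.
    by exists (x i + v)%MM; rewrite ?addmA // mem_msum // mem_vars //; lia.
  apply/fsetP => w; apply/msumP/idP => [[u [v []]]|].
    rewrite /A !inE => /orP[/translateP[u' Hu ->]|Bu] /orP[/translateP[v' Hv ->]|Bv] ->.
    - apply/orP; left; apply/translateP; exists (u' + v')%MM;
      first exact: mem_msum.
      by apply/mnmP => k; rewrite !mnmDE; lia.
    - by have := mixed _ _ Hu Bv; rewrite !inE.
    - by rewrite addmC; have := mixed _ _ Hv Bu; rewrite !inE.
    - by apply/orP; right; apply/orP; right; apply: mem_msum.
  rewrite /A !inE => /orP[/translateP[_ /msumP[u [v [Hu Hv ->]]] ->]|].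
    exists (x s + u)%MM, (x s + v)%MM; split; rewrite ?inE.
    + by apply/orP; left; apply/translateP; exists u.
    + by apply/orP; left; apply/translateP; exists v.
    + by apply/mnmP => k; rewrite !mnmDE; lia.
  case/orP=> [/translateP[_ /msumP[u [v [Hu Hv ->]]] ->]|/msumP[u [v [Bu Bv ->]]]].
    exists (x s + u)%MM, v; split; rewrite ?inE ?Hv ?orbT ?addmA //.
    by apply/orP; left; apply/translateP; exists u => //; apply: vars_widen Hu.
  by exists u, v; rewrite !inE Bu Bv !orbT.
rewrite (@card_fsetU_deg o 2).
- congr addn; first by rewrite card_translate.
  rewrite (@card_fsetU_deg o 1) ?card_translate //.
    by move=> _ /translateP[u _ ->]; rewrite mnmDE xvarE so eqxx.
  by move=> u; rewrite ltnS leqn0 => Hu; apply/eqP; move: u Hu;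
    apply: msum_deg0.
- by move=> _ /translateP[u _ ->]; rewrite !mnmDE !xvarE so eqxx.
- move=> u; rewrite inE => /orP[/translateP[v Hv ->]|Hu].
    by rewrite mnmDE xvarE (msum_deg0 V0 B0 Hv); lia.
  by rewrite (msum_deg0 B0 B0 Hu).
Qed.

End Row.

Lemma shifted_inv s q A : shifted s q A -> A = fset0 \/
  exists p B, [/\ (s < p <= q)%N, shifted s.+1 p B
    & A = translate (x s) (vars s p) `|` B].
Proof. by case=> [{}s {}q|{}s p {}q B spq sB]; [left|right; exists p, B]. Qed.

Lemma leq_card_vars_msum s q A : (0 < s)%N -> shifted s q A ->
  (#|` A| <= #|` msum (vars s q) A|)%N.
Proof.
move=> s0 /shifted_inv[->|[p [B [spq _ ->]]]]; first by rewrite cardfs0.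
set A' := _ `|` _; rewrite -(card_translate (x s) A').
apply/fsubset_leq_card/fsubsetP => _ /translateP[u Hu ->].
by apply: mem_msum => //; apply: mem_vars; lia.
Qed.

(** The inequality that forces the classification. When a row with [d] elements
is removed and [w = q - s], the row alone accounts for a surplus of
[d * (2 * w - d - 1) / 2], which is positive when [w >= 2]; the rest is the
induction hypothesis for [B] in the [d - 1] variables of the row after [x_s],
together with one translate of [B] inside the sumset of [B] and these
variables. *)
Lemma shifted_surplus s q A : (0 < s < q)%N -> (q <= n.+1)%N -> shifted s q A ->
  ((q - s + 2) * #|` A| + ((1 < q - s) && (A != fset0)) <=
   2 * #|` msum (vars s q) A| + #|` msum A A|)%N.
Proof.
move=> + + sA; elim: sA => [{}s {}q _ _|{}s p {}q B spq sB IH sq qn].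
  by rewrite cardfs0 muln0 eqxx andbF.
have s0 : (0 < s)%N by lia.
have sp : (s < p)%N by lia.
have {}IH : ((p - s + 1) * #|` B| <=
    2 * #|` msum (vars s.+1 p) B| + #|` msum B B|)%N.
  have [->|B0] := eqVneq B fset0; first by rewrite cardfs0 muln0.
  have [B0'|[r [C [srp _ _]]]] := shifted_inv sB;
    first by rewrite B0' eqxx in B0.
  have -> : (p - s + 1 = p - s.+1 + 2)%N by lia.
  by apply: leq_trans (leq_addr _ _) (IH _ _); lia.
have X1 := leq_card_vars_msum (ltn0Sn s) sB.
rewrite card_row //; last lia.
rewrite card_vars_row //; last lia.
rewrite (@card_vars_msum s.+1 p q) //; try lia.
rewrite card_row_row //; last lia.
have := @card_msum_vars s p q; have := @card_msum_vars s p p.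
move: (#|` msum (vars s p) (vars s p)|) (#|` msum (vars s p) (vars s q)|) => t1 t2.
move: IH X1; move: #|` B| (#|` msum (vars s.+1 p) B|) (#|` msum B B|) => b X Y IH X1.
move=> /(_ s0) t1E /(_ s0) t2E.
have {}t1E := t1E ltac:(lia) ltac:(lia).
have {}t2E := t2E ltac:(lia) ltac:(lia).
have : (1 < q - s) && (translate (x s) (vars s p) `|` B != fset0) <= (1 < q - s)%N.
  by case: (1 < q - s)%N => //=; case: (_ != _).
move: (_ && _ : nat) => e He.
move Ew: (q - s)%N => w; move Ed: (p - s)%N => d;
  rewrite Ew Ed in t1E t2E IH He *.
(* All counts become polynomials in [d], [a] and [b]: [d] is the length of the
   row and [a] the number of variables beyond it. *)
have [a wE] : exists a, w = (d + a)%N by exists (w - d)%N; lia.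
have -> : (q - p = a)%N by lia.
have {}t1E : (t1 * 2 = d * (d + 1))%N by rewrite t1E; congr muln; lia.
have {}t2E : (t2 * 2 = d * (d + 2 * a + 1))%N by rewrite t2E; congr muln; lia.
subst w.
have d0 : (0 < d)%N by lia.
move: He; case: (ltnP 1 (d + a)) => He ea; nia.
Qed.

Lemma msum_fset0 A : msum A fset0 = fset0.
Proof. by apply/fsetP => w; rewrite inE; apply/msumP => -[u [v []]]. Qed.

Lemma double_bin2 k : ('C(k, 2) * 2 = k * k.-1)%N.
Proof. by rewrite (bin_ffact _ 2) ffactnS ffactn1. Qed.

Lemma card_freiman_one_row q : (1 < q <= n.+1)%N ->
  let A := translate (x 1) (vars 1 q) in
  (#|` msum A A| + 'C(q.-1, 2) = q.-1 * #|` A|)%N.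
Proof.
move=> qn A; rewrite /A -(fsetU0 (translate _ _)).
rewrite card_row ?card_row_row ?msum_fset0 ?cardfs0 //; try lia;
  try exact: shifted_nil.
have := @card_msum_vars 1 q q isT ltac:(lia) ltac:(lia).
have := double_bin2 q.-1; have -> : (q = q.-2.+2)%N by lia.
by move: #|` _| => t /=; rewrite subn1 /=; nia.
Qed.

(** The contributions of the two rows to both sides of the Freiman equation
cancel, and so does every term that contains [q]. *)
Lemma card_freiman_two_rows q p C : (2 < p <= q)%N -> (q <= n.+1)%N ->
  shifted 3 p C ->
  let A := translate (x 1) (vars 1 q) `|` (translate (x 2) (vars 2 p) `|` C) in
  (#|` msum A A| + 'C(q.-1, 2) = q.-1 * #|` A|)%N <->
  (2 * #|` msum (vars 3 p) C| + #|` msum C C| = p.-1 * #|` C|)%N.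
Proof.
move=> pq qn sC A; have sB : shifted 2 q (translate (x 2) (vars 2 p) `|` C).
  exact: shifted_row.
rewrite /A card_row ?card_row_row //; try lia.
rewrite card_row // ?card_row_row // ?card_vars_row //; try lia.
rewrite (@card_vars_msum 3 p q) //; try lia.
have := @card_msum_vars 1 q q isT; move: (#|` msum (vars 1 q) (vars 1 q)|) => t.
have := @card_msum_vars 2 p q isT; have := @card_msum_vars 2 p p isT.
move: (#|` msum (vars 2 p) (vars 2 p)|) (#|` msum (vars 2 p) (vars 2 q)|).
move=> t1 t2 /(_ ltac:(lia) ltac:(lia)) t1E /(_ ltac:(lia) ltac:(lia)) t2E.
move=> /(_ ltac:(lia) ltac:(lia)) tE.
have := double_bin2 q.-1.
have [d pE] : exists d, p = d.+3 by exists (p - 3)%N; lia.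
have [a qE] : exists a, q = (d + a).+3 by exists (q - p)%N; lia.
have -> : (q - p = a)%N by lia.
have -> : (p - 2 = d.+1)%N by lia.
have -> : (q - 1 = (d + a).+2)%N by lia.
have {}tE : (t * 2 = (d + a).+2 * (d + a).+3)%N by rewrite tE qE; congr muln;
  lia.
have {}t1E : (t1 * 2 = d.+1 * d.+2)%N by rewrite t1E pE; congr muln; lia.
have {}t2E : (t2 * 2 = d.+1 * (d + 2 * a + 2))%N.
  by rewrite t2E pE qE; congr muln; lia.
rewrite pE qE /=.
move: #|` C| #|` msum (vars _ _) C| #|` msum C C| => c X Y binE.
by split; nia.
Qed.

Lemma vars1 k : vars k k.+1 = [fset x k].
Proof.
apply/fsetP => u; rewrite inE; apply/varsP/eqP => [[i ki ->]|->].
  by have -> : i = k by lia.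
by exists k; rewrite ?leqnn ?ltnSn.
Qed.

Lemma shifted_square k q : (k < q)%N -> shifted k q [fset (x k + x k)%MM].
Proof.
move=> kq; have -> : [fset (x k + x k)%MM] =
  translate (x k) (vars k k.+1) `|` fset0.
  rewrite fsetU0 vars1; apply/fsetP => u; rewrite inE.
  by apply/eqP/translateP => [->|[v]]; [exists (x k);
    rewrite ?inE|rewrite inE => /eqP->].
by apply: shifted_row; [rewrite ltnSn|apply: shifted_nil].
Qed.

Lemma card_freiman_shifted q B : (1 < q <= n.+1)%N -> shifted 2 q B ->
  let A := translate (x 1) (vars 1 q) `|` B in
  (#|` msum A A| + 'C(q.-1, 2) = q.-1 * #|` A|)%N <->
  B = fset0 \/ exists2 p, (2 < p <= q)%N &
    B = translate (x 2) (vars 2 p) \/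
    p = 4 /\ B = translate (x 2) (vars 2 4) `|` [fset (x 3 + x 3)%MM].
Proof.
move=> qn sB A; split=> [|[B0|[p pq [BE|[p4 BE]]]]].
- have [B0|[p [C [pq sC BE]]]] := shifted_inv sB; first by left.
  have qn' : (q <= n.+1)%N by lia.
  move=> Afr; right; exists p => //; move: Afr.
  have [C0 _|C0] := eqVneq C fset0; first by left; rewrite BE C0 fsetU0.
  rewrite /A BE => /(card_freiman_two_rows pq qn' sC) E.
  have [C0'|[r [C' [rp sC' CE]]]] := shifted_inv sC;
    first by rewrite C0' eqxx in C0.
  have p4 : p = 4.
    have := shifted_surplus _ _ sC; rewrite E C0 andbT.
    move=> /(_ ltac:(lia) ltac:(lia)).
    have -> : (p - 3 + 2 = p.-1)%N by lia.
    lia.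
  right; split=> //; rewrite CE p4; congr (_ `|` _).
  have [->|[r' [C'' [? _ _]]]] := shifted_inv sC'; last by lia.
  have -> : r = 4 by lia.
  by rewrite fsetU0 vars1; apply/fsetP => u; rewrite inE;
    apply/translateP/eqP => [[v]|->]; [rewrite inE => /eqP->|exists (x 3);
      rewrite ?inE].
- by rewrite /A B0 fsetU0; apply: card_freiman_one_row.
- rewrite /A BE -(fsetU0 (translate (x 2) _)).
  apply/(card_freiman_two_rows pq _ (shifted_nil 3 p)); first lia.
  by rewrite !msum_fset0 cardfs0 !muln0.
- have sC := shifted_square (ltnSn 3).
  rewrite /A BE -p4; rewrite p4 in pq *;
    apply/(card_freiman_two_rows pq _ sC); first lia.
  have msum1 u v : msum [fset u] [fset v] = [fset (u + v)%MM].
    apply/fsetP => w; rewrite inE; apply/msumP/eqP => [[? [? []]]|->].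
      by rewrite !inE => /eqP-> /eqP->.
    by exists u, v; rewrite !inE.
  by rewrite vars1 !msum1 !cardfs1.
Qed.
End Shifted.

(** * Monomial ideals *)

Section MonomialIdeal.
Variables (K : fieldType) (n : nat).
Local Notation S := {mpoly K[n]}.
Local Notation T := 'X_{1..n}.
Local Open Scope ring_scope.
Local Open Scope classical_set_scope.
Local Notation gen A := (ideal_gen (@monomials K n A)).
Implicit Types (f g : S) (u v w : T) (A B Q : set T) (I J : set S).

(** A monomial ideal is the set of polynomials supported in an upward closed set
of monomials; membership is tested monomial by monomial. *)
Definition supported Q : set S := [set f | forall u, u \in msupp f -> Q u].

Lemma supported0 Q : supported Q 0.
Proof. by move=> u; rewrite msupp0. Qed.

Lemma supportedD Q f g : supported Q f -> supported Q g -> supported Q (f + g).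
Proof. by move=> Qf Qg u /msuppD_le; rewrite mem_cat => /orP[/Qf|/Qg]. Qed.

Lemma supportedM Q1 Q2 Q f g :
  (forall u v, Q1 u -> Q2 v -> Q (u + v)%MM) ->
  supported Q1 f -> supported Q2 g -> supported Q (f * g).
Proof.
by move=> Q12 Qf Qg _ /msuppM_le/allpairsP[[u v] /= [/Qf Qu /Qg Qv ->]];
  apply: Q12.
Qed.

Lemma supportedX Q u : Q u <-> supported Q 'X_[u].
Proof.
split=> [Qu v|]; first by rewrite msuppX inE => /eqP->.
by apply; rewrite msuppX inE.
Qed.

Definition above A : set T := [set u | exists2 a, A a & (a <= u)%MM].

Lemma ideal_gen_monomials A : gen A = supported (above A).
Proof.
have upper u v : above A v -> above A (u + v)%MM.
  by case=> a Aa av; exists a => //; apply: lepm_trans av (lem_addl _ _).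
apply/seteqP; split=> f.
  apply: (@ideal_gen_min _ _ (supported (above A))).
    split=> [|g h|g h Hh]; [exact: supported0|exact: supportedD|].
    apply: (@supportedM setT (above A)) (Hh) => [u v _|//]; exact: upper.
  move=> _ [u Au <-]; apply/supportedX; exists u => //; exact: lepm_refl.
move=> Hf; have iA := ideal_gen_ideal (@monomials K n A).
rewrite (mpolyE f) big_seq; apply: ideal_sum => // u /Hf[a Aa au].
rewrite -(submK au) mpolyXD -mul_mpolyC mulrA.
have [_ _ M] := iA; apply: M; apply: ideal_gen_sub; by exists a.
Qed.

Lemma ideal_gen_monomialsX A u : gen A 'X_[u] <-> above A u.
Proof. by rewrite ideal_gen_monomials -supportedX. Qed.

Lemma eq_ideal_gen_monomials A B : gen A = gen B
  <-> above A = above B.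
Proof.
split=> [E|E]; last by rewrite !ideal_gen_monomials E.
by apply/seteqP; split=> u; rewrite /= -!ideal_gen_monomialsX E.
Qed.

Definition antichain A := forall u v, A u -> A v -> (u <= v)%MM -> u = v.

Lemma lepm_anti u v : (u <= v)%MM -> (v <= u)%MM -> u = v.
Proof.
by move=> /mnm_lepP uv /mnm_lepP vu; apply/mnmP => i; apply/anti_leq;
  rewrite uv vu.
Qed.

(** An element of the antichain [A] lies above some element of [B], which in
turn lies above an element of [A]: both must be equal. *)
Lemma antichain_above A B : antichain A -> above A = above B -> A `<=` B.
Proof.
move=> antiA E a Aa; have : above B a by rewrite -E; exists a => //;
  exact: lepm_refl.
case=> b Bb ba; have : above A b by rewrite E; exists b => //; exact: lepm_refl.
case=> a' Aa' a'b; have a'a := antiA _ _ Aa' Aa (lepm_trans a'b ba).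
by rewrite (lepm_anti _ ba) // -a'a.
Qed.

Lemma mingens_antichain A : antichain A -> mingens (gen A) = A.
Proof.
move=> antiA; apply: xget_unique => [|B [/eq_ideal_gen_monomials E minB]].
  split=> // B BA /eq_ideal_gen_monomials E; apply/seteqP; split=> //.
  exact: antichain_above.
by apply/esym/minB => //; exact: antichain_above.
Qed.

Definition minimal_elements A : set T :=
  [set u | A u /\ forall v, A v -> (v <= u)%MM -> v = u].

Lemma mdeg_lepm u v : (u <= v)%MM -> (mdeg u <= mdeg v)%N.
Proof. by move=> /submK <-; rewrite mdegD leq_addl. Qed.

Lemma lepm_mdeg u v : (u <= v)%MM -> (mdeg v <= mdeg u)%N -> u = v.
Proof.
move=> /submK <-; rewrite mdegD -[X in (_ <= X)%N]add0n leq_add2r leqn0 mdeg_eq0.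
by move=> /eqP->; rewrite add0m.
Qed.

(** Divisibility is well founded because proper divisors have smaller degree. *)
Lemma minimal_elements_below A u : A u ->
  exists2 v, minimal_elements A v & (v <= u)%MM.
Proof.
move: {2}(mdeg u) (leqnn (mdeg u)) => d; elim: d u => [|d IH] u ud Au.
  exists u; last exact: lepm_refl.
  by split=> // v Av vu; apply: lepm_mdeg vu _; apply: leq_trans ud _.
have [min_u|] := pselect (forall v, A v -> (v <= u)%MM -> v = u).
  by exists u; [split|exact: lepm_refl].
move=> /existsNP[v /not_implyP[Av /not_implyP[vu v_u]]].
have [|w minw wv] := IH v _ Av; last by exists w => //; apply: lepm_trans wv vu.
rewrite -ltnS; apply: leq_trans ud; rewrite ltnNge; apply/negP => uv.
by apply: v_u; apply: lepm_mdeg.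
Qed.

(** The minimal elements of any generating set form the minimal generating
set. *)
Lemma monomial_ideal_mingens I : monomial_ideal I -> I = gen (mingens I).
Proof.
move=> [A IE]; have antiA : antichain (minimal_elements A).
  by move=> u v [Au _] [_ minv] uv; apply: minv.
have AE : above A = above (minimal_elements A).
  apply/seteqP; split=> u [a Aa au]; last by exists a => //; case: Aa.
  by have [b minb ba] := minimal_elements_below Aa; exists b => //;
    apply: lepm_trans ba au.
by rewrite IE (eq_ideal_gen_monomials A (minimal_elements A)).2 // mingens_antichain.
Qed.

Definition mset_sum A B : set T :=
  [set w | exists u v, [/\ A u, B v & w = (u + v)%MM]].

Lemma ideal_mul_monomials A B :
  ideal_mul (gen A) (gen B) =
  gen (mset_sum A B).
Proof.
apply/seteqP; split=> f.
  apply: ideal_gen_min (ideal_gen_ideal _) _ f => _ [f [g [+ + ->]]].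
  rewrite !ideal_gen_monomials; apply: supportedM => u v [a Aa au] [b Bb bv].
  exists (a + b)%MM; first by exists a, b.
  by apply/mnm_lepP => i; rewrite !mnmDE leq_add //; apply/mnm_lepP.
apply: ideal_gen_min (ideal_gen_ideal _) _ f => _ [_ [a [b [Aa Bb ->]]] <-].
rewrite mpolyXD; apply: ideal_gen_sub; exists 'X_[a], 'X_[b].
by split=> //; apply: ideal_gen_sub; [exists a|exists b].
Qed.

Lemma ideal_gen_monomials0 : gen [set 0%MM] = setT.
Proof.
rewrite ideal_gen_monomials; apply/seteqP; split=> // f _ u _.
by exists 0%MM => //; apply/mnm_lepP => i; rewrite mnm0E.
Qed.

Definition mset_iter A k : set T := iter k (mset_sum A) [set 0%MM].

Lemma ideal_pow_monomials A k :
  ideal_pow (gen A) k = gen (mset_iter A k).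
Proof.
elim: k => [|k IH]; first by rewrite ideal_gen_monomials0.
by rewrite /= -/(ideal_pow _ k) IH ideal_mul_monomials.
Qed.

Lemma mdeg_mset_iter A d k : (forall u, A u -> mdeg u = d) ->
  forall u, mset_iter A k u -> mdeg u = (d * k)%N.
Proof.
move=> Ad; elim: k => [|k IH] u /=; first by move=> ->; rewrite mdeg0 muln0.
by move=> [v [w [/Ad vd /IH wk ->]]]; rewrite mdegD vd wk mulnS.
Qed.

Lemma antichain_mdeg A d : (forall u, A u -> mdeg u = d) -> antichain A.
Proof. by move=> Ad u v /Ad ud /Ad vd uv; apply: lepm_mdeg uv _;
  rewrite ud vd. Qed.

(** The exchange property of the minimal generators extends to all monomials of
the ideal: with [u = a v] and [a] a generator, the variable is exchanged in [a]
if it occurs there and in [v] otherwise. *)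
Lemma borel_monomial I u (i j : 'I_n) : borel I -> I 'X_[u] ->
  u j != 0%N -> (i < j)%N -> I 'X_[(U_(i) + (u - U_(j)))%MM].
Proof.
move=> [/monomial_ideal_mingens IE Ib] Iu uj ij.
move: Iu; rewrite {1}IE => /ideal_gen_monomialsX[a Ga au].
have iI : ideal I by rewrite IE; exact: ideal_gen_ideal.
have [aj|aj] := eqVneq (a j) 0%N.
  rewrite IE; apply/ideal_gen_monomialsX; exists a => //.
  apply/mnm_lepP => k; rewrite mnmDE mnmBE !mnm1E.
  have [<-|jk] := eqVneq j k; first by rewrite aj.
  by move/mnm_lepP/(_ k): au; lia.
have -> : (U_(i) + (u - U_(j)) = (u - a) + (U_(i) + (a - U_(j))))%MM.
  apply/mnmP => k; rewrite !(mnmDE, mnmBE, mnm1E).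
  move/mnm_lepP/(_ k): au; have [<-|jk] := eqVneq j k; first by move: aj; lia.
  by lia.
by rewrite mpolyXD; have [_ _ M] := iI; apply: M; apply: Ib.
Qed.

End MonomialIdeal.

(** * Borel ideals generated by quadratic monomials *)

Section BorelSpan.
Variable n : nat.
Local Notation T := 'X_{1..n}.
Local Notation x := (xvar n).
Implicit Types (ps : seq (nat * nat)) (p : nat * nat).

(** The last column of row [i] (0 if the row is empty) in the Borel closure of
the monomials [x_a x_b], for [(a, b)] in [ps]: the largest [j] for which
[x_i x_j] lies below one of them. *)
Definition reach ps i := \max_(p <- ps | (i <= p.1)%N) p.2.

(** Built row by row like [shifted]; row [i] ends at column [L i]. *)
Fixpoint staircase (L : nat -> nat) k s : {fset T} :=
  if k is k'.+1 then (translate (x s) (vars n s (L s).+1) `|` staircase L k' s.+1)%fset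
  else fset0.

Definition borel_closure ps := staircase (reach ps) n 1.

Lemma staircaseP L k s u :
  reflect (exists i j, [/\ (s <= i < s + k)%N, (i <= j <= L i)%N
    & u = (x i + x j)%MM])
    (u \in staircase L k s).
Proof.
elim: k s u => [|k IH] s u /=; first by rewrite inE; right=> -[i [j [? _ _]]];
  lia.
rewrite inE; apply: (iffP orP) => [[/translateP[_ /varsP[j ? ->] ->]|/IH[i [j [? ? ->]]]]|].
- by exists s, j; split=> //; lia.
- by exists i, j; split=> //; lia.
move=> [i [j [Hi Hj ->]]]; have [is_|i_s] := eqVneq i s; last first.
  by right; apply/IH; exists i, j; split=> //; lia.
by left; apply/translateP; subst i; exists (x j) => //; apply: mem_vars; lia.
Qed.

(** Row lengths decrease, so once a row is empty all later rows are empty. *)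
Lemma staircase_shifted L k s q : {homo L : i j / (i <= j)%N >-> (j <= i)%N} ->
  (L s < q)%N -> shifted s q (staircase L k s).
Proof.
move=> mono_L; elim: k s q => [|k IH] s q Lsq; first exact: shifted_nil.
have [sL|Ls] := leqP s (L s).
  apply: shifted_row; first lia.
  by apply: IH; rewrite ltnS mono_L.
have -> : staircase L k.+1 s = fset0; last exact: shifted_nil.
apply/fsetP => u; rewrite in_fset0;
  apply/negP => /staircaseP[i [j [/andP[si _] ij _]]].
by have := mono_L _ _ si; lia.
Qed.

Lemma reach_mono ps : {homo reach ps : i j / (i <= j)%N >-> (j <= i)%N}.
Proof.
move=> i j ij; apply/bigmax_leqP_seq => p ps_p jp.
by apply: (leq_bigmax_seq p) => //; apply: leq_trans ij jp.
Qed.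

Lemma reachP ps i j : (0 < j)%N ->
  (j <= reach ps i)%N = has (fun p => (i <= p.1) && (j <= p.2))%N ps.
Proof.
move=> j0; rewrite /reach; elim: ps => [|p ps IH] /=;
  first by rewrite big_nil; lia.
by rewrite big_cons; case: (i <= p.1)%N; rewrite -IH //= leq_max.
Qed.

Definition index_pairs ps :=
  all (fun p => (1 <= p.1 <= p.2) && (p.2 <= n))%N ps.

Lemma borel_closureP ps u : index_pairs ps ->
  reflect (exists i j, [/\ (1 <= i <= j)%N, has (fun p => (i <= p.1) && (j <= p.2))%N ps
                         & u = (x i + x j)%MM])
    (u \in borel_closure ps).
Proof.
move=> /allP gps; apply: (iffP (staircaseP _ _ _ _)) => -[i [j [Hi Hj ->]]];
  exists i, j.
  by split=> //; [lia|rewrite -reachP; lia].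
split=> //; last by rewrite -reachP in Hj; lia.
by have /hasP[p /gps] := Hj; lia.
Qed.

Lemma borel_closure_shifted ps : index_pairs ps ->
  shifted 1 n.+1 (borel_closure ps).
Proof.
move=> /allP gps; apply: staircase_shifted; first exact: reach_mono.
by rewrite ltnS; apply/bigmax_leqP_seq => p /gps; lia.
Qed.

Lemma mdeg_xvar k : (1 <= k <= n)%N -> mdeg (x k) = 1.
Proof.
move=> Hk; have [//|o ko] := @var_ord n k;
  rewrite mdegE (bigD1 o) //= xvarE ko eqxx.
rewrite big1 ?addn0 // => i /negbTE io.
by rewrite xvarE eqSS eq_sym -[_ == _]/(i == o) io.
Qed.

Lemma mdeg_borel_closure ps u : index_pairs ps -> u \in borel_closure ps ->
  mdeg u = 2.
Proof.
move=> gps /(borel_closureP _ gps)[i [j [Hij /hasP[p Hp /= Hip] ->]]].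
by have /allP/(_ p Hp) /= pn := gps; rewrite mdegD !mdeg_xvar //; lia.
Qed.

Lemma xvar_ord (o : 'I_n) : x o.+1 = U_(o)%MM.
Proof. by apply/mnmP => i; rewrite [LHS]xvarE [RHS]mnm1E eqSS. Qed.

Local Notation gens ps := [seq (x p.1 + x p.2)%MM | p <- ps].

(** The closure satisfies the exchange property, and conversely each of its
elements is reached from a generator by moving the two variables down one after
the other. *)
Lemma borel_spanE (K : fieldType) ps : index_pairs ps ->
  borel_span K (gens ps) = ideal_gen (monomials [set` borel_closure ps]).
Proof.
move=> gps; apply/seteqP; split.
  apply: smallest_sub; last first.
    move=> _ [u /= /mapP[p Hp ->] <-]; apply: ideal_gen_sub.
    exists (x p.1 + x p.2)%MM => //=; apply/(borel_closureP _ gps);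
      exists p.1, p.2.
    split=> //; first by have /allP/(_ p Hp) /= := gps; lia.
    by apply/hasP; exists p; rewrite ?leqnn.
  split; first by exists [set` borel_closure ps]%classic.
  rewrite mingens_antichain; last by apply: antichain_mdeg => u;
    apply: mdeg_borel_closure.
  move=> u /= /(borel_closureP _ gps)[a [b [ab Hps ->]]] i j uj ij.
  have bn : (b <= n)%N by have /hasP[p /(allP gps)] := Hps; lia.
  have [a' a_a'] : exists o : 'I_n, a = o.+1 by apply: var_ord; lia.
  have [b' b_b'] : exists o : 'I_n, b = o.+1 by apply: var_ord; lia.
  have key c d : (1 <= c)%N -> (1 <= d)%N ->
    (c <= a /\ d <= b \/ d <= a /\ c <= b)%N ->
      ideal_gen (monomials [set` borel_closure ps]) ('X_[(x c + x d)] :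
        {mpoly K[n]}).
    wlog cd : c d / (c <= d)%N.
      move=> H c1 d1 cdab; case: (leqP c d) => [|/ltnW] le; first by apply: H.
      by rewrite addmC; apply: H => //; lia.
    move=> c1 d1 cdab; apply: ideal_gen_sub; exists (x c + x d)%MM => //=.
    apply/(borel_closureP _ gps); exists c, d; split=> //; first lia.
    by apply: sub_has Hps => p /=; lia.
  have : j = a' \/ j = b'.
    have [->|ja] := eqVneq j a'; first by left.
    have [->|jb] := eqVneq j b'; first by right.
    move: uj; rewrite a_a' b_b' !xvar_ord mnmDE !mnm1E ![_ == j]eq_sym.
    by rewrite (negbTE ja) (negbTE jb).
  case=> jE.
    have -> : (U_(i) + (x a + x b - U_(j)) = x i.+1 + x b)%MM.
      rewrite a_a' !xvar_ord jE; apply/mnmP => k; rewrite !(mnmDE, mnmBE); lia.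
    by apply: key; move: ij; rewrite jE; lia.
  have -> : (U_(i) + (x a + x b - U_(j)) = x i.+1 + x a)%MM.
    rewrite b_b' !xvar_ord jE; apply/mnmP => k; rewrite !(mnmDE, mnmBE); lia.
  by apply: key; move: ij; rewrite jE; lia.
move=> f Hf J [bJ Jgens]; move: f Hf; apply: ideal_gen_min.
  by rewrite (monomial_ideal_mingens bJ.1); exact: ideal_gen_ideal.
move=> _ [_ /= /(borel_closureP _ gps)[c [d [cd /hasP[[a b] Hp /= /andP[cp dp]] ->]]] <-].
have /allP/(_ (a, b) Hp) /= := gps => Hp'.
have move_down k l v : (1 <= k <= l)%N -> (l <= n)%N ->
    J 'X_[(x l + v)%MM] -> J 'X_[(x k + v)%MM].
  move=> ab bn; have [->//|a_b] := eqVneq k l.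
  have [a' a_a'] : exists o : 'I_n, k = o.+1 by apply: var_ord; lia.
  have [b' b_b'] : exists o : 'I_n, l = o.+1 by apply: var_ord; lia.
  move=> /(@borel_monomial _ _ _ _ a' b' bJ) H.
  rewrite a_a' b_b' !xvar_ord in H *.
  have -> : (U_(a') + v = U_(a') + (U_(b') + v - U_(b')))%MM.
    by apply/mnmP => h; rewrite !(mnmDE, mnmBE); lia.
  by apply: H; [rewrite mnmDE mnm1E eqxx|clear -ab a_b a_a' b_b'; lia].
apply: (move_down _ a) => //; [lia..|].
rewrite addmC; apply: (move_down _ b) => //; [lia..|].
rewrite addmC; apply: Jgens; exists (x a + x b)%MM => //=.
by apply/mapP; exists (a, b).
Qed.

End BorelSpan.

(** * Chains of primes and algebraic dependence *)

Section PrimeChains.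
Local Open Scope ring_scope.
Local Open Scope classical_set_scope.

Section Primes.
Variables (R : comNzRingType) (P : set R).
Hypothesis prP : prime_ideal P.

Lemma prime_idealD a b : P a -> P b -> P (a + b).
Proof. by have [[_ D _] _ _] := prP; apply: D. Qed.

Lemma prime_idealM a b : P b -> P (a * b).
Proof. by have [[_ _ M] _ _] := prP; apply: M. Qed.

Lemma prime_idealB a b : P (a + b) -> P b -> P a.
Proof. by move=> Pab Pb; rewrite -(addrK b a) -mulN1r;
  apply/prime_idealD/prime_idealM. Qed.

Lemma prime_idealX a b m : ~ P a -> P (a ^+ m * b) -> P b.
Proof.
move=> Pa; elim: m => [|m IH]; first by rewrite mul1r.
by rewrite exprS -mulrA; case: prP => _ _ M /M[//|/IH].
Qed.

End Primes.

(** Pick [x i] in [P i.+1] outside [P i]. A polynomial relation between the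
[x i] is contradictory: working in [P 0], divide by the largest power of [x 0]
that occurs in all terms (possible, as [x 0] is not in the prime [P 0]) and pass
to [P 1], where the terms still divisible by [x 0] disappear. Repeating this for
each variable leaves the coefficient of the lexicographically least term, which
would lie in [P d]. *)
Lemma prime_chain_dependence (R : comNzRingType) (P : nat -> set R) (d N : nat)
    (x : 'I_d -> R) (c : {ffun 'I_d -> 'I_N} -> R) :
  prime_chain P d -> (forall i : 'I_d, P i.+1 (x i) /\ ~ P i (x i)) ->
  (exists a, c a != 0) -> (forall a, c a != 0 -> ~ P d (c a)) ->
  \sum_a c a * \prod_i x i ^+ a i = 0 -> False.
Proof.
move=> [prP subP] xP [a0 ca0] cP rel.
have claim k : (k <= d)%N -> exists A : {set {ffun 'I_d -> 'I_N}},
    [/\ A != finset.set0, forall a, a \in A -> c a != 0,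
        forall a b (i : 'I_d), a \in A -> b \in A -> (i < k)%N -> a i = b i
      & P k (\sum_(a in A) c a * \prod_(i < d | (k <= i)%N) x i ^+ a i)].
  elim: k => [_|k IH kd].
    exists [set a | c a != 0]%SET; split=> [|a|a b i //|].
    - by apply/finset.set0Pn; exists a0; rewrite finset.inE.
    - by rewrite finset.inE.
    have -> : \sum_(a in [set a | c a != 0]%SET)
        c a * \prod_(i < d | (0 <= i)%N) x i ^+ a i = 0; last first.
      by have [[]] := prP 0 isT.
    rewrite -[RHS]rel [RHS](bigID (fun a => c a != 0)) /= [X in _ =
      _ + X]big1 ?addr0.
      by apply: eq_big => [a|a _]; rewrite ?finset.inE.
    by move=> a /negPn/eqP->; rewrite mul0r.
  have [A [/finset.set0Pn[a1 Aa1] Ac Aeq PA]] := IH (ltnW kd).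
  (* Among the terms that agree in the first [k] exponents, [A'] collects those
     with the least exponent of [x o]. *)
  pose o := Ordinal kd; pose m := [arg min_(a < a1 in A) a o].
  have [Am minm] : m \in A /\ forall a, a \in A -> (m o <= a o)%N.
    by rewrite /m; case: arg_minnP.
  pose A' := [set a in A | a o == m o]%SET.
  exists A'; split.
  - by apply/finset.set0Pn; exists m; rewrite !finset.inE Am eqxx.
  - by move=> a; rewrite finset.inE => /andP[/Ac].
  - move=> a b i; rewrite !finset.inE => /andP[Aa /eqP ao] /andP[Ab /eqP bo].
    rewrite ltnS leq_eqVlt => /orP[/eqP ik|]; last exact: Aeq.
    by have -> : i = o; [apply: val_inj|rewrite ao bo].
  pose rest (a : {ffun 'I_d ->
    'I_N}) := \prod_(i < d | (k.+1 <= i)%N) x i ^+ a i.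
  have prk : prime_ideal (P k) by apply: prP; apply: ltnW.
  have prk1 : prime_ideal (P k.+1) by apply: prP.
  have [xk1 xk] := xP o.
  have splitk (a : {ffun 'I_d -> 'I_N}) :
      \prod_(i < d | (k <= i)%N) x i ^+ a i = x o ^+ a o * rest a.
    rewrite (bigD1 o) //=; congr (_ * _); apply: eq_bigl => i.
    by rewrite andbC -val_eqE /= ltn_neqAle eq_sym.
  have PkA : P k (\sum_(a in A) c a * (x o ^+ (a o - m o) * rest a)).
    apply: (prime_idealX prk (m := m o) xk); rewrite mulr_sumr.
    move: PA; congr (P k _); apply: eq_bigr => a Aa.
    by rewrite splitk [RHS]mulrCA [x o ^+ m o * _]mulrA -exprD subnKC ?minm.
  have {}PkA : P k.+1 (\sum_(a in A) c a * (x o ^+ (a o - m o) * rest a)).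
    by have [+ _] := subP _ kd; apply.
  move: PkA; rewrite (bigID (fun a : {ffun 'I_d ->
    'I_N} => a o == m o)) /= => /(prime_idealB prk1) PA'.
  have -> : \sum_(a in A') c a * rest a =
      \sum_(a in A | a o == m o) c a * (x o ^+ (a o - m o) * rest a).
    apply: eq_big => [a|a]; rewrite !finset.inE //.
    by move=> /andP[_ /eqP->]; rewrite subnn mul1r.
  apply: PA'; apply: ideal_sum; first by have [] := prk1.
  move=> a /andP[Aa ao]; apply: prime_idealM => //; rewrite mulrC.
  apply: prime_idealM => //.
  have -> : (a o - m o = (a o - m o).-1.+1)%N.
    by rewrite prednK // subn_gt0 ltn_neqAle eq_sym minm // andbT.
  by rewrite exprSr; apply: prime_idealM.
have [A [/finset.set0Pn[a Aa] Ac Aeq]] := claim d (leqnn d).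
rewrite (big_pred1 a) => [|b /=]; last first.
  apply/idP/eqP => [Ab|->//]; apply/ffunP => i; exact: Aeq.
rewrite big1 ?mulr1; first exact/cP/Ac.
by move=> i; rewrite leqNgt ltn_ord.
Qed.

End PrimeChains.

Section AlgebraicDependence.
Variables (K : fieldType) (n d : nat).
Local Notation S := {mpoly K[n]}.
Local Notation T := 'X_{1..n}.
Local Open Scope ring_scope.
Local Open Scope classical_set_scope.

Definition first_vars : set T := [set u | forall o : 'I_n, (d <= o)%N ->
  u o = 0].

Let bounded e : set T := [set u | (mdeg u <= e)%N /\ first_vars u].

Let boundedM e1 e2 (f g : S) :
  supported (bounded e1) f -> supported (bounded e2) g ->
    supported (bounded (e1 + e2)) (f * g).
Proof.
apply: supportedM => u v [ue u0] [ve v0].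
by split=> [|o od]; rewrite ?mdegD ?leq_add // mnmDE u0 ?v0.
Qed.

Let bounded1 : supported (bounded 0) (1 : S).
Proof. by move=> u; rewrite msupp1 inE => /eqP->; split=> [|o];
  rewrite ?mdeg0 ?mnm0E. Qed.

(** The monomials in the [y i] with exponents below [N] number [N ^ d.+1], while
they lie in a space of dimension at most [(c * N) ^ d] with [c] independent of
[N]; for large [N] they are linearly dependent. *)
Lemma algebraic_dependence (y : 'I_d.+1 -> S) :
  (forall i, supported first_vars (y i)) ->
  exists N (c : {ffun 'I_d.+1 -> 'I_N} -> K),
    (exists a, c a != 0) /\ \sum_a (c a)%:MP * \prod_i y i ^+ a i = 0.
Proof.
move=> y0; pose e := (\max_i msize (y i)).+1.
have ye i : supported (bounded e) (y i).
  move=> u yu; split; last exact: y0 yu.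
  by rewrite ltnW // ltnS; apply: leq_trans (leq_bigmax i);
    apply/ltnW/msize_mdeg_lt.
(* [N ^ d.+1] exceeds [(d.+1 * e * N) ^ d] as soon as [N > (d.+1 * e) ^ d]. *)
pose N := ((d.+1 * e) ^ d).+1.
pose M := (d.+1 * e * N).-1.
have M0 : (0 < d.+1 * e * N)%N by rewrite !muln_gt0.
pose mon (b : {ffun 'I_d -> 'I_M.+1}) : T :=
  [multinom (if insub (o : nat) : option 'I_d is Some k then b k :
    nat else 0%N) | o < n].
pose Y (a : {ffun 'I_d.+1 -> 'I_N}) := \prod_i y i ^+ a i.
have Ysupp a u : u \in msupp (Y a) -> exists b, u = mon b.
  move=> Yu; have [] : bounded (\sum_(i < d.+1) (e * a i)) u.
    move: u Yu; rewrite -/(supported _ _) /Y.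
    apply: (big_ind2 (fun f k => supported (bounded k) f)) => //.
      by move=> f k g l; apply: boundedM.
    move=> i _; elim: (a i : nat) => [|k IH]; first by rewrite muln0.
    by rewrite exprS mulnS; apply: boundedM.
  move=> ue u0; have {}ue : (mdeg u <= M)%N.
    apply: (leq_trans ue); rewrite -ltnS prednK //.
    have : (\sum_(i < d.+1) e * a i <= \sum_(i < d.+1) e * N.-1)%N.
      by apply: leq_sum => i _; rewrite leq_mul2l -ltnS prednK ?ltn_ord ?orbT.
    by rewrite sum_nat_const card_ord; rewrite /N /=; nia.
  exists [ffun k : 'I_d => inord (nth 0%N u k)]; apply/mnmP => o; rewrite mnmE.
  case: insubP => [k _ ko|]; last by rewrite -leqNgt => /u0.
  rewrite ffunE inordK ko -mnm_nth // ltnS; apply: leq_trans ue.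
  by rewrite mdegE (bigD1 o) //= leq_addr.
pose A := \matrix_(i < #|{: {ffun 'I_d.+1 -> 'I_N}}|, j < #|{: {ffun 'I_d ->
  'I_M.+1}}|)
  (Y (enum_val i))@_(mon (enum_val j)).
have : kermx A != 0.
  rewrite kermx_eq0; apply/negP => /eqP rkA.
  have := rank_leq_col A; rewrite rkA !card_ffun !card_ord /M prednK //.
  rewrite expnMn expnS leqNgt ltn_pmul2r ?expn_gt0 //.
  by rewrite ltnS leqnn.
case/rowV0Pn => v /sub_kermxP vA v0.
exists N, (fun a => v ord0 (enum_rank a)); split.
  have [j vj] : exists j, v ord0 j != 0.
    by apply/existsP; apply: contraNT v0 => /existsPn v0; apply/eqP/rowP => j;
      rewrite mxE; apply/eqP/negPn.
  by exists (enum_val j); rewrite enum_valK.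
apply/mpolyP => u; rewrite mcoeff0 raddf_sum /=.
have [[b ->]|nob] := pselect (exists b, u = mon b); last first.
  apply: big1 => a _; rewrite mcoeffCM memN_msupp_eq0 ?mulr0 //.
  by apply/negP => /Ysupp.
have /rowP/(_ (enum_rank b)) := vA; rewrite !mxE => vAb; rewrite -[RHS]vAb.
rewrite (reindex (@enum_val _ predT)) /=; last by apply/onW_bij/enum_val_bij.
apply: eq_bigr => i _; rewrite mcoeffCM !mxE enum_rankK.
by rewrite enum_valK.
Qed.

End AlgebraicDependence.

(** A ring that embeds into a polynomial ring in [d] variables has dimension at
most [d], provided that it contains the scalars. *)
Lemma prime_chain_bound (R : comNzRingType) (K : fieldType) (n d : nat)
    (phi : {rmorphism R -> {mpoly K[n]}}) (kappa : K -> R) :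
  injective phi -> (forall c, phi (kappa c) = c%:MP_[n])%R ->
  (forall y, supported (first_vars d) (phi y)) ->
  forall (P : nat -> set R) e, prime_chain P e -> (e <= d)%N.
Proof.
move=> phi_inj phiK phi_vars P e chP; rewrite leqNgt; apply/negP => de.
have chP' : prime_chain P d.+1.
  case: chP => pr sub; split=> k kd; [apply: pr|apply: sub];
    exact: leq_trans kd de.
have /choice[x xP] : forall i : 'I_d.+1, exists y, P i.+1 y /\ ~ P i y.
  move=> i; have [_ /(_ i (ltn_ord i))[_ sub]] := chP'.
  by move/existsNP: sub => [y /not_implyP]; exists y.
have kappa0 c : (kappa c == 0)%R = (c == 0)%R.
  by rewrite -(inj_eq phi_inj) phiK rmorph0 mpolyC_eq0.
have [N [c [[a ca] rel]]] :=
  @algebraic_dependence K n d (phi \o x) (fun i => phi_vars (x i)).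
apply: (@prime_chain_dependence R P d.+1 N x (kappa \o c) chP' xP).
- by exists a; rewrite /= kappa0.
- move=> b; rewrite /= kappa0 => cb Pcb.
  have [/(_ _ (leqnn _)) pr _] := chP'; have [_ + _] := pr; apply.
  have -> : 1%R = (kappa (c b)^-1 * kappa (c b))%R.
    by apply: phi_inj; rewrite rmorph1 rmorphM !phiK -mpolyCM mulVf.
  exact: prime_idealM.
- apply: phi_inj; rewrite rmorph0 -[RHS]rel rmorph_sum; apply: eq_bigr => b _.
  rewrite rmorphM phiK rmorph_prod; congr (_ * _)%R; apply: eq_bigr => i _.
  by rewrite rmorphXn.
Qed.

(** * The fiber ring and the analytic spread *)

Section CoordinateChain.
Variables (K : fieldType) (n : nat).
Local Notation S := {mpoly K[n]}.
Local Notation x := (xvar n).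
Local Open Scope ring_scope.
Local Open Scope classical_set_scope.
Implicit Types (f : S) (u : 'X_{1..n}).

(** Substitution of 0 for all variables after the first [j]; its kernel is the
prime ideal generated by them. *)
Definition kill_vars j : n.-tuple S :=
  [tuple if (i < j)%N then 'X_i else 0 | i < n].

Lemma kill_varsX j u :
  'X_[u] \mPo kill_vars j = if `[< first_vars j u >] then 'X_[u] else 0.
Proof.
rewrite comp_mpolyX; case: asboolP => [u0|/existsNP[o /not_implyP[jo /eqP uo]]].
  rewrite mpolyXE_id; apply: eq_bigr => i _; rewrite tnth_mktuple.
  by case: ltnP => // /u0->; rewrite !expr0.
by rewrite (bigD1 o) //= tnth_mktuple ltnNge jo /= expr0n (negbTE uo) mul0r.
Qed.

Lemma kill_varsS i j f : (i <= j)%N ->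
  (f \mPo kill_vars j) \mPo kill_vars i = f \mPo kill_vars i.
Proof.
move=> ij; rewrite (mpolyE f) (raddf_sum (comp_mpoly (kill_vars j))).
rewrite !(raddf_sum (comp_mpoly (kill_vars i))); apply: eq_bigr => u _.
rewrite /= !comp_mpolyZ; congr (_ *: _); rewrite (kill_varsX j).
case: asboolP => [//|uj]; rewrite comp_mpoly0 kill_varsX.
case: asboolP => // ui; case: uj => o jo; apply: ui; exact: leq_trans ij jo.
Qed.

(** The chain consists of the kernels of [phi] followed by the substitutions
that kill the last [k] of the first [d] variables. The image [x_1 x_k] witnesses
strictness: it survives until [x_k] itself is killed. *)
Lemma exists_prime_chain (R : comNzRingType) (phi : {rmorphism R -> S}) d :
  (d <= n)%N -> (forall k, (1 <= k <= d)%N ->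
    exists y, phi y = 'X_[(x 1 + x k)%MM]) ->
  exists P : nat -> set R, prime_chain P d.
Proof.
move=> dn phiX; exists (fun k => [set y : R | phi y \mPo kill_vars (d - k) =
  0]).
split=> k kd.
  split=> [|/=|y z /=].
  - split=> /= [|y z y0 z0|y z z0]; first by rewrite !rmorph0.
      by rewrite !rmorphD /= y0 z0 addr0.
    by rewrite !rmorphM /= z0 mulr0.
  - by rewrite !rmorph1 => /eqP; rewrite oner_eq0.
  - by rewrite !rmorphM /= => /eqP; rewrite mulf_eq0 => /orP[]/eqP;
    [left|right].
have [|y yE] := phiX (d - k)%N; first lia.
split=> [z /= z0|/(_ y)]; first by rewrite -(@kill_varsS _ (d - k)) ?z0 ?comp_mpoly0 //; lia.
rewrite /= yE !kill_varsX; case: asboolP => [u0 _|_].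
  have [|o ko] := @var_ord n (d - k)%N; first lia.
  by have := u0 o; rewrite mnmDE !xvarE ko eqxx; lia.
case: asboolP => [_ /(_ erefl)/eqP|[]]; first by rewrite -msupp_eq0 msuppX.
by move=> o ko; rewrite mnmDE !xvarE; lia.
Qed.

End CoordinateChain.

Section FiberRingEmbedding.
Variables (K : fieldType) (n : nat).
Local Notation S := {mpoly K[n]}.
Local Notation T := 'X_{1..n}.
Local Open Scope ring_scope.
Local Open Scope classical_set_scope.
Implicit Types (f g : S) (u v : T).

Lemma mcoeff_pihomog d f u :
  (pihomog mdeg d f)@_u = if mdeg u == d then f@_u else 0.
Proof.
have fu : f@_u = \sum_(v <- msupp f) (f@_v *: 'X_[v])@_u.
  by rewrite {1}[f]mpolyE raddf_sum.
have -> : (pihomog mdeg d f)@_u =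
  \sum_(v <- msupp f | mdeg v == d) (f@_v *: 'X_[v])@_u.
  by rewrite pihomogE raddf_sum.
case: eqP => [ud|/eqP ud].
  rewrite fu [RHS](bigID (fun v => mdeg v == d)) /= [X in _ =
    _ + X]big1 ?addr0 // => v vd.
  rewrite mcoeffZ mcoeffX; case: eqP => [vu|_]; last by rewrite mulr0.
  by rewrite vu ud eqxx in vd.
apply: big1 => v /eqP vd; rewrite mcoeffZ mcoeffX; case: eqP => [vu|_];
  last by rewrite mulr0.
by rewrite -vu vd eqxx in ud.
Qed.

(** The lowest homogeneous component is multiplicative. *)
Lemma pihomog_lowest d e f g :
  supported [set u | (d <= mdeg u)%N] f ->
    supported [set u | (e <= mdeg u)%N] g ->
  pihomog mdeg (d + e) (f * g) = pihomog mdeg d f * pihomog mdeg e g.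
Proof.
have low k (h : S) : supported [set u | (k <= mdeg u)%N] h ->
    supported [set u | (k < mdeg u)%N] (h - pihomog mdeg k h).
  move=> hk u; rewrite mcoeff_msupp mcoeffB mcoeff_pihomog.
  have [_|uk] := eqVneq (mdeg u) k; first by rewrite subrr eqxx.
  by rewrite subr0 -mcoeff_msupp => /hk ku /=; rewrite ltn_neqAle eq_sym uk.
have lowest k (h : S) : supported [set u | (k <= mdeg u)%N] (pihomog mdeg k h).
  move=> u; rewrite mcoeff_msupp mcoeff_pihomog.
  by have [uk _|_] := eqVneq (mdeg u) k; rewrite /= ?uk ?eqxx.
have high k (h : S) : supported [set u | (k < mdeg u)%N] h ->
  pihomog mdeg k h = 0.
  move=> hk; apply/mpolyP => u; rewrite mcoeff_pihomog mcoeff0.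
  case: eqP => // uk; apply: memN_msupp_eq0; apply/negP => /hk /=.
  by rewrite uk ltnn.
move=> fd ge.
have -> : f * g = (f - pihomog mdeg d f) * g
    + (pihomog mdeg d f * (g - pihomog mdeg e g) + pihomog mdeg d f * pihomog mdeg e g).
  by rewrite -mulrDr subrK -mulrDl subrK.
rewrite !pihomogD (high _ ((f - _) * g)); last first.
  by apply: supportedM (low _ _ fd) ge => u v /= du ev;
    rewrite mdegD -addSn leq_add.
rewrite high ?add0r; last first.
  by apply: supportedM (lowest d f) (low _ _ ge) => u v /= du ev;
    rewrite mdegD -addnS leq_add.
by apply: pihomog_dE; apply: dhomogM; apply: pihomogP.
Qed.

Variables (A : set T) (delta : nat).
Hypotheses (delta_gt0 : (0 < delta)%N) (degA : forall u, A u -> mdeg u = delta).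
Local Notation I := (ideal_gen (@monomials K n A)).

Let coef_rees k (p : rees I) :
  supported (above (mset_iter A k)) (rees_val p)`_k.
Proof.
case: p => p /= /asboolP/(_ k);
  by rewrite ideal_pow_monomials ideal_gen_monomials.
Qed.

Let coef_rees_low k (p : rees I) :
  supported [set u | (delta * k <= mdeg u)%N] (rees_val p)`_k.
Proof.
by move=> u /coef_rees[a /(mdeg_mset_iter degA) <-]; apply: mdeg_lepm.
Qed.

(** The coefficient of [t^k] in an element of the Rees algebra has degree at
least [delta * k]; only the part of exactly this degree survives in the fiber
ring. *)
Let lead (p : {poly S}) : {poly S} :=
  \poly_(k < size p) pihomog mdeg (delta * k) p`_k.

Let coef_lead p k : (lead p)`_k = pihomog mdeg (delta * k) p`_k.
Proof.
by rewrite coef_poly; case: ltnP => // kp;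
  rewrite [p`_k]nth_default // pihomog0.
Qed.

Let leadB p q : lead (p - q) = lead p - lead q.
Proof. by apply/polyP => k; rewrite !(coefB, coef_lead) pihomogB. Qed.

Let leadM (p q : rees I) : lead (rees_val (p * q)) =
  lead (rees_val p) * lead (rees_val q).
Proof.
apply/polyP => k; rewrite coef_lead !coefM raddf_sum;
  apply: eq_bigr => -[i /=] ik _.
by rewrite !coef_lead -pihomog_lowest // -mulnDr subnKC.
Qed.

(** Setting [t = 1] loses nothing, since [k] is recovered from the degree
[delta * k]. *)
Let initial (p : rees I) : S := (lead (rees_val p)).[1].

Let initialE p : initial p =
  \sum_(k < size (rees_val p)) pihomog mdeg (delta * k) (rees_val p)`_k.
Proof. by rewrite /initial horner_poly; apply: eq_bigr => i _;
  rewrite expr1n mulr1. Qed.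

Let mcoeff_initial p k u : mdeg u = (delta * k)%N ->
  (initial p)@_u = ((rees_val p)`_k)@_u.
Proof.
move=> uk; rewrite initialE raddf_sum /=.
have [kp|kp] := ltnP k (size (rees_val p)); last first.
  rewrite nth_default // mcoeff0; apply: big1 => i _; rewrite mcoeff_pihomog uk.
  by rewrite eqn_pmul2l //; case: eqP => // ki; have := ltn_ord i;
    rewrite -ki ltnNge kp.
rewrite (bigD1 (Ordinal kp)) //= mcoeff_pihomog uk eqxx big1 ?addr0 // => i ik.
by rewrite mcoeff_pihomog uk eqn_pmul2l // eq_sym -[_ == _]/(i == Ordinal kp) (negbTE ik).
Qed.

Let unit_mons : set T := [set U_(i)%MM | i in setT].

Let max_idealE : @max_ideal K n = ideal_gen (@monomials K n unit_mons).
Proof.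
congr ideal_gen; apply/seteqP; split=> f.
  by move=> [i _ <-]; exists U_(i)%MM => //; exists i.
by move=> [_ [i _ <-] <-]; exists i.
Qed.

Let fiber_predP (p : rees I) : reflect
  (forall k, supported (above (mset_sum unit_mons (mset_iter A k))) (rees_val p)`_k)
  (fiber_pred p).
Proof.
have E k : ideal_mul (@max_ideal K n) (ideal_pow I k) =
    supported (above (mset_sum unit_mons (mset_iter A k))) :> set S.
  by rewrite ideal_pow_monomials max_idealE ideal_mul_monomials ideal_gen_monomials.
by apply: (iffP (asboolP _)) => H k; have := H k; rewrite E.
Qed.

(** A monomial of [I^k] lies in [m I^k] exactly when its degree exceeds
[delta * k]. *)
Let initial_eq0 p : initial p = 0 <-> fiber_pred p.
Proof.
split=> [p0|/fiber_predP pk].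
  apply/fiber_predP => k u uk; have [a Aa au] := coef_rees uk.
  have [uak|ua] := eqVneq u a.
    move: uk; rewrite mcoeff_msupp -mcoeff_initial ?p0 ?mcoeff0 ?eqxx //.
    by rewrite uak (mdeg_mset_iter degA Aa).
  have [i ui] : exists i, (a i < u i)%N.
    apply: contrapT => /forallNP ua'; move/eqP: ua; apply; apply: lepm_anti au.
    by apply/mnm_lepP => i; rewrite leqNgt; apply/negP/ua'.
  exists (U_(i) + a)%MM; first by exists U_(i)%MM, a; split=> //; exists i.
  apply/mnm_lepP => j; rewrite mnmDE mnm1E; move/mnm_lepP/(_ j): au.
  by have [<- _|] := eqVneq i j.
rewrite initialE big1 // => k _; apply/mpolyP => u;
  rewrite mcoeff_pihomog mcoeff0.
case: eqP => // uk; apply: memN_msupp_eq0; apply/negP.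
move=> /pk[_ [_ [a [[i _ <-] Aa ->]]] /mdeg_lepm].
by rewrite mdegD mdeg1 (mdeg_mset_iter degA Aa) uk ltnn.
Qed.

Let initialB p q : initial (p - q) = initial p - initial q.
Proof. by rewrite /initial leadB hornerD hornerN. Qed.

Local Open Scope quotient_scope.

Let fiber_map (y : fiber_ring I) : S := initial (repr y).

Let fiber_map_pi p : fiber_map (\pi p) = initial p.
Proof.
apply/eqP; rewrite -subr_eq0 -initialB; apply/eqP/initial_eq0.
by have := Quotient.idealrBE (@fiber_pred K n I) (repr (\pi_({ideal_quot (@fiber_pred K n I)}) p)) p; rewrite reprK eqxx.
Qed.

(** [phi] keeps the components of degree [delta * k] on a representative; by
[initial_eq0] this is well defined and injective. [kappa] provides the
scalars. *)
Lemma fiber_ring_embedding :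
  exists (phi : {rmorphism fiber_ring I -> S}) (kappa : K -> fiber_ring I),
  [/\ injective phi, forall c, phi (kappa c) = c%:MP,
      forall y, supported [set u | exists k, mset_iter A k u] (phi y)
    & forall a, A a -> exists y, phi y = 'X_[a]].
Proof.
have fiber_mapP y : exists2 p, y = \pi p & fiber_map y = initial p.
  by exists (repr y); rewrite ?reprK.
have fiber_mapB : zmod_morphism fiber_map.
  move=> y z; have [p -> ->] := fiber_mapP y; have [q -> ->] := fiber_mapP z.
  by rewrite -initialB -fiber_map_pi rmorphB.
have leadC f : lead f%:P = (pihomog mdeg 0 f)%:P.
  apply/polyP => k; rewrite [LHS]coef_lead [RHS]coefC [f%:P`_k]coefC.
  by case: k => [|k]; [rewrite muln0|exact: pihomog0].
have pihomog0_const c : pihomog mdeg 0 c%:MP = c%:MP :> S.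
  by apply/mpolyP => u; rewrite mcoeff_pihomog mcoeffC mdeg_eq0; case: eqP;
    rewrite ?mulr0.
have initial1 : initial 1 = 1.
  by rewrite /initial /= -polyC1 leadC hornerC pihomog0_const.
have fiber_mapM : monoid_morphism fiber_map.
  split=> [|y z]; first by rewrite -initial1 -fiber_map_pi rmorph1.
  have [p -> ->] := fiber_mapP y; have [q -> ->] := fiber_mapP z.
  by rewrite -rmorphM fiber_map_pi /initial leadM hornerM.
pose mB := GRing.isZmodMorphism.Build _ _ fiber_map fiber_mapB.
pose mM := GRing.isMonoidMorphism.Build _ _ fiber_map fiber_mapM.
pose phi : {rmorphism fiber_ring I -> S} := HB.pack fiber_map mB mM.
have constP c : (c%:MP)%:P \in rees_pred I.
  apply/asboolP => k; rewrite coefC; case: k => [|k] //=.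
  by have [] := ideal_pow_ideal I k.+1.
exists phi, (fun c => \pi_({ideal_quot (@fiber_pred K n I)}) (Rees (constP c))); split=> [|c|y u|a Aa].
- apply: raddf_inj => y /=; have [p -> ->] := fiber_mapP y;
  move/initial_eq0 => p0.
  rewrite -(rmorph0 (\pi_({ideal_quot (@fiber_pred K n I)}))); apply/eqP.
  by rewrite -Quotient.idealrBE subr0.
- by rewrite /phi /= fiber_map_pi /initial /= leadC hornerC pihomog0_const.
- rewrite /phi /=; have [p _ ->] := fiber_mapP y; rewrite mcoeff_msupp => pu.
  have [k uk] : exists k, mdeg u = (delta * k)%N.
    apply: contrapT => /forallNP uk; move/eqP: pu; apply.
    rewrite initialE raddf_sum /=; apply: big1 => i _; rewrite mcoeff_pihomog.
    by case: eqP => // /uk.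
  exists k; move: pu; rewrite (mcoeff_initial p uk) -mcoeff_msupp => /coef_rees[a Aa au].
  by rewrite -(lepm_mdeg au) // uk (mdeg_mset_iter degA Aa).
- have Xa : 'X_[a] *: 'X \in rees_pred I.
    apply/asboolP => k; rewrite coefZ coefX; case: eqP => [->|_]; last first.
      by rewrite mulr0; have [] := ideal_pow_ideal I k.
    rewrite mulr1 ideal_pow_monomials; apply: ideal_gen_sub; exists a => //.
    by exists a, 0%MM; rewrite addm0.
  exists (\pi_({ideal_quot (@fiber_pred K n I)}) (Rees Xa)).
  rewrite /phi /= fiber_map_pi /initial /=.
  have -> : lead ('X_[a] *: 'X) = 'X_[a] *: 'X.
    apply/polyP => k; rewrite coef_lead !coefZ coefX; case: eqP => [->|_];
      last first.
      by rewrite mulr0 pihomog0.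
    by rewrite mulr1 muln1; apply: pihomog_dE; rewrite dhomogX; apply/eqP/degA.
  by rewrite hornerZ hornerX mulr1.
Qed.
End FiberRingEmbedding.

(** The monomials [x_1 x_k] give a chain of length [d], and the embedding into a
polynomial ring in [d] variables bounds all chains. *)
Lemma analytic_spread_quadric (K : fieldType) (n d : nat) (A : set 'X_{1..n}) :
  (d <= n)%N -> (forall u, A u -> mdeg u = 2 /\ first_vars d u) ->
  (forall k, (1 <= k <= d)%N -> A (xvar n 1 + xvar n k)%MM) ->
  analytic_spread (ideal_gen (@monomials K n A)) d.
Proof.
move=> dn AP Ax.
have degA u : A u -> mdeg u = 2 by case/AP.
have [phi [kappa [phi_inj phiK phi_supp phiA]]] :=
  @fiber_ring_embedding K n A 2 isT degA.
split.
  by apply: (exists_prime_chain (phi := phi)) => // k /Ax/phiA.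
apply: prime_chain_bound phi_inj phiK _ => y u /phi_supp[k].
elim: k u => [|k IH] u /=; first by move=> -> o _; rewrite mnm0E.
by move=> [v [w [/AP[_ v0] /IH w0 ->]]] o od; rewrite mnmDE v0 ?w0.
Qed.

(** * Freiman ideals *)

Section FreimanIdeal.
Variables (K : fieldType) (n : nat).
Local Notation x := (xvar n).
Local Notation gen A := (ideal_gen (@monomials K n [set` A])).
Local Notation gens ps := [seq (x p.1 + x p.2)%MM | p <- ps].

(** The number [l] in the definition of a Freiman ideal is thereby pinned to the
value computed in [analytic_spread_quadric]. *)
Lemma krull_dim_unique (R : comNzRingType) d e : krull_dim R d ->
  krull_dim R e -> d = e.
Proof.
move=> [[P Pd] maxd] [[Q Qe] maxe]; apply/anti_leq.
by rewrite (maxe _ _ Pd) (maxd _ _ Qe).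
Qed.

Lemma mdeg_msum A B d e : {in A, forall u, mdeg u = d} ->
  {in B, forall u, mdeg u = e} ->
  {in msum A B, forall u : 'X_{1..n}, mdeg u = (d + e)%N}.
Proof. by move=> Ad Be _ /msumP[u [v [/Ad ud /Be ve ->]]];
  rewrite mdegD ud ve. Qed.

Lemma mdeg_shifted s q A : (0 < s)%N -> (q <= n.+1)%N -> shifted s q A ->
  {in A, forall u : 'X_{1..n}, mdeg u = 2}.
Proof.
move=> s0 qn /shifted_sub/fsubsetP AW u /AW;
  apply: (@mdeg_msum _ _ 1 1) u => u /varsP[k Hk ->];
  by apply: mdeg_xvar; lia.
Qed.

Lemma mu_monomials A d : {in A, forall u, mdeg u = d} -> mu (gen A) = #|` A|.
Proof.
move=> Ad; rewrite /mu mingens_antichain ?set_fsetK //.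
exact: antichain_mdeg Ad.
Qed.

Lemma ideal_pow2_monomials A : ideal_pow (gen A) 2 = gen (msum A A).
Proof.
rewrite ideal_pow_monomials; congr (ideal_gen (monomials _)).
apply/seteqP; split=> u /=.
  by move=> [v [_ [Av [w [_ [Aw -> ->]]] ->]]]; rewrite addm0 mem_msum.
move/msumP => [v [w [Av Aw ->]]]; exists v, w; split=> //.
by exists w, 0%MM; rewrite addm0.
Qed.

Lemma freiman_shifted q B : (1 < q <= n.+1)%N -> shifted 2 q B ->
  let A := (translate (x 1) (vars n 1 q) `|` B)%fset in
  freiman (gen A) <-> (#|` msum A A| + 'C(q.-1, 2) = q.-1 * #|` A|)%N.
Proof.
move=> qn sB A; have sA : shifted 1 q A by apply: shifted_row;
  rewrite // leqnn andbT; lia.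
have degA : {in A, forall u : 'X_{1..n}, mdeg u =
  2} by apply: mdeg_shifted sA; lia.
have spread : analytic_spread (gen A) q.-1.
  apply: analytic_spread_quadric => [|u Au|k Hk]; first lia.
    split=> [|o Ho]; first exact: degA.
    by apply: shifted_deg0 sA _ Au; lia.
  rewrite /= inE; apply/orP; left; apply/translateP; exists (x k) => //.
  by apply: mem_vars; lia.
have muA : mu (gen A) = #|` A| by apply: mu_monomials degA.
have muA2 : mu (ideal_pow (gen A) 2) = #|` msum A A|.
  by rewrite ideal_pow2_monomials; apply: mu_monomials (mdeg_msum degA degA).
split=> [[_ _ [l spreadl]]|E].
  by rewrite -(krull_dim_unique spread spreadl) muA muA2; lia.
split.
- by exists [set` A]%classic.
- exists 2; rewrite mingens_antichain //; exact: antichain_mdeg degA.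
- by exists q.-1 => //; rewrite muA muA2; lia.
Qed.

(** Stated for an arbitrary list [ps] because the staircases of
[[:: (1, a); (2, a)]] and of [[:: (2, a)]] agree; this is where one generator
turns out to be enough. *)
Lemma borel_closure_two_rows ps a b : index_pairs n ps -> (2 <= b <= a)%N ->
  (forall i j, 1 <= i <= j -> has (fun p => (i <= p.1) && (j <= p.2)) ps =
     (i <= 1) && (j <= a) || (i <= 2) && (j <= b))%N ->
  borel_closure n ps = (translate (x 1) (vars n 1 a.+1) `|` translate (x 2) (vars n 2 b.+1))%fset.
Proof.
move=> gps ab psE; apply/fsetP => u; rewrite inE.
apply/(borel_closureP _ gps)/orP => [[i [j [ij + ->]]]|].
  rewrite psE // => H; have [i1|i1] := eqVneq i 1.
    by left; apply/translateP; subst i; exists (x j) => //; apply: mem_vars;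
      lia.
  have i2 : i = 2 by lia.
  by right; apply/translateP; subst i; exists (x j) => //; apply: mem_vars; lia.
case=> /translateP[_ /varsP[j Hj ->] ->].
  by exists 1, j; split=> //; [lia|rewrite psE; lia].
by exists 2, j; split=> //; [lia|rewrite psE; lia].
Qed.

(** Likewise the staircases of [[:: (1, 3); (3, 3)]] and of [[:: (3, 3)]]
agree. *)
Lemma borel_closure_three_rows ps a : index_pairs n ps -> (3 <= a)%N ->
  (forall i j, 1 <= i <= j -> has (fun p => (i <= p.1) && (j <= p.2)) ps =
     (i <= 1) && (j <= a) || (i <= 3) && (j <= 3))%N ->
  borel_closure n ps = (translate (x 1) (vars n 1 a.+1) `|`
    (translate (x 2) (vars n 2 4) `|` [fset (x 3 + x 3)%MM]))%fset.
Proof.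
move=> gps a3 psE; apply/fsetP => u; rewrite in_fsetU in_fsetU in_fset1.
apply/(borel_closureP _ gps)/or3P => [[i [j [ij + ->]]]|].
  rewrite psE // => H; have [i1|i1] := eqVneq i 1.
    by constructor 1; apply/translateP; subst i; exists (x j) => //;
      apply: mem_vars; lia.
  have [i2|i2] := eqVneq i 2.
    by constructor 2; apply/translateP; subst i; exists (x j) => //;
      apply: mem_vars; lia.
  have i3 : i = 3 by lia.
  have j3 : j = 3 by lia.
  by constructor 3; rewrite i3 j3.
case=> [/translateP[_ /varsP[j Hj ->] ->]|/translateP[_ /varsP[j Hj ->] ->]|/eqP->].
- by exists 1, j; split=> //; [lia|rewrite psE; lia].
- by exists 2, j; split=> //; [lia|rewrite psE; lia].
- by exists 3, 3; split=> //; rewrite psE.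
Qed.

Lemma borel_closure_one_row a : (1 <= a <= n)%N ->
  borel_closure n [:: (1, a)] = translate (x 1) (vars n 1 a.+1).
Proof.
move=> Ha; have gps : index_pairs n [:: (1, a)] by rewrite /index_pairs /=; lia.
apply/fsetP => u; apply/(borel_closureP _ gps)/translateP => [[i [j [ij + ->]]]|].
  move=> /= H; have i1 : i = 1 by lia.
  by subst i; exists (x j) => //; apply: mem_vars; lia.
by move=> [_ /varsP[j Hj ->] ->]; exists 1, j; split=> //=; lia.
Qed.

(** The case of one generator [x_1 x_a] is included, as are the lists
[[:: (1, a); (2, a)]] and [[:: (1, 3); (3, 3)]] that one generator replaces. *)
Lemma freiman_borel_span ps : index_pairs n ps -> borel_closure n ps != fset0 ->
  freiman (borel_span K (gens ps)) <->
  exists a, (1 <= a <= n)%N /\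
   (borel_closure n ps = borel_closure n [:: (1, a)] \/
    (exists2 b, (2 <= b <= a)%N
      & borel_closure n ps = borel_closure n [:: (1, a); (2, b)]) \/
    ((3 <= a)%N /\ borel_closure n ps = borel_closure n [:: (1, a); (3, 3)])).
Proof.
move=> gps ps0; rewrite borel_spanE //; set C := borel_closure n ps.
have two a b : (2 <= b <= a)%N -> (a <= n)%N -> borel_closure n [:: (1, a);
  (2, b)] =
    (translate (x 1) (vars n 1 a.+1) `|` translate (x 2) (vars n 2 b.+1))%fset.
  by move=> ab an; apply: borel_closure_two_rows; rewrite /index_pairs /=; lia.
have three a : (3 <= a <= n)%N -> borel_closure n [:: (1, a); (3, 3)] =
    (translate (x 1) (vars n 1 a.+1) `|`
    (translate (x 2) (vars n 2 4) `|` [fset (x 3 + x 3)%MM]))%fset.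
  by move=> an; apply: borel_closure_three_rows; rewrite /index_pairs /=; lia.
have fr a B : (1 <= a <= n)%N -> shifted 2 a.+1 B ->
    C = (translate (x 1) (vars n 1 a.+1) `|` B)%fset -> freiman (gen C) <->
    B = fset0 \/ exists2 p, (2 < p <= a.+1)%N
      & B = translate (x 2) (vars n 2 p) \/
      p = 4 /\ B = (translate (x 2) (vars n 2 4) `|` [fset (x 3 + x 3)%MM])%fset.
  by move=> an sB ->; rewrite -card_freiman_shifted // freiman_shifted.
split=> [|[a [an [CE|[[b ab CE]|[a3 CE]]]]]].
- have [C0|[q' [B [qn sB CE]]]] := shifted_inv (borel_closure_shifted gps).
    by rewrite C0 eqxx in ps0.
  have [q q'E] : exists q, q' = q.+1 by exists q'.-1; lia.
  subst q'; have qn' : (1 <= q <= n)%N by lia.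
  move/(fr q B qn' sB CE) => H; exists q; split=> //.
  case: H => [B0|[p pq [BE|[p4 BE]]]].
  + by left; rewrite borel_closure_one_row // /C CE B0 fsetU0.
  + by right; left; exists p.-1; [lia|rewrite two ?prednK;
    [rewrite /C CE BE|lia..]].
  + by right; right; split; [lia|rewrite three; [rewrite /C CE BE|lia]].
- apply/(fr a fset0) => //; [exact: shifted_nil|..|by left].
  by rewrite CE borel_closure_one_row // fsetU0.
- apply/(fr a (translate (x 2) (vars n 2 b.+1))) => //.
  + rewrite -(fsetU0 (translate _ _)); apply: shifted_row;
    [lia|exact: shifted_nil].
  + by rewrite CE two //; lia.
  + by right; exists b.+1; [lia|left].
- apply/(fr a (translate (x 2) (vars n 2 4) `|` [fset (x 3 + x 3)%MM])%fset) => //.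
  + by apply: shifted_row; [lia|apply: shifted_square].
  + by rewrite CE three //; lia.
  + by right; exists 4; [lia|right].
Qed.

End FreimanIdeal.

Theorem theorem1p6 (n : nat) (K : fieldType) (m : nat) (i j : 'I_m -> nat)
    (I : set {mpoly K[n]}) :
  (3 <= n)%N -> (2 <= m)%N ->
  (forall k, [/\ (1 <= i k)%N, (i k <= j k)%N & (j k <= n)%N]) ->
  I = borel_span K [seq (xvar n (i k) + xvar n (j k))%MM | k : 'I_m] ->
  min_borel_gens I m ->
  freiman I <->
    (exists j1 j2 : nat, [/\ (2 <= j2)%N, (j2 < j1)%N, (j1 <= n)%N &
       I = borel_span K [:: (xvar n 1 + xvar n j1)%MM; (xvar n 2 + xvar n j2)%MM]])
    \/
    (exists j1 : nat, [/\ (3 < j1)%N, (j1 <= n)%N &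
       I = borel_span K [:: (xvar n 1 + xvar n j1)%MM; (xvar n 3 *+ 2)%MM]]).
Proof.
move=> n3 m2 ijP IE [_ minI].
pose gens ps := [seq (xvar n p.1 + xvar n p.2)%MM | p <- ps].
have closure_n0 p ps : index_pairs n (p :: ps) ->
  borel_closure n (p :: ps) != fset0.
  move=> gps; apply/fset0Pn; exists (xvar n p.1 + xvar n p.2)%MM.
  apply/(borel_closureP _ gps); exists p.1, p.2; rewrite /= !leqnn; split=> //.
  by case/andP: gps => /andP[].
have x3E : (xvar n 3 *+ 2 = xvar n 3 + xvar n 3)%MM.
  by rewrite mulmS mulm1n.
split; last first.
  case=> [[a [b [b2 ba an IE']]]|[a [a3 an]]]; last rewrite x3E => IE'.
    have gps : index_pairs n [:: (1, a); (2, b)] by rewrite /index_pairs /=;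
      lia.
    rewrite IE' -[X in borel_span K X]/(gens [:: (1, a); (2, b)]).
    apply/(freiman_borel_span K gps (closure_n0 _ _ gps)).
    by exists a; split; [lia|right; left; exists b => //; lia].
  have gps : index_pairs n [:: (1, a); (3, 3)] by rewrite /index_pairs /=; lia.
  rewrite IE' -[X in borel_span K X]/(gens [:: (1, a); (3, 3)]).
  apply/(freiman_borel_span K gps (closure_n0 _ _ gps)).
  by exists a; split; [lia|right; right; split=> //; lia].
pose ps := [seq (i k, j k) | k : 'I_m].
have psE : [seq (xvar n (i k) + xvar n (j k))%MM | k : 'I_m] = gens ps.
  by rewrite /gens /ps /image_mem -map_comp.
have gps : index_pairs n ps.
  by apply/allP => _ /mapP[k _ ->] /=; have [] := ijP k; lia.
have ps0 : borel_closure n ps != fset0.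
  have : size ps = m by rewrite size_image card_ord.
  by move: gps; case: (ps) => [|p ps'] gps' => [/= m0|_];
    [lia|apply: closure_n0].
have spanE qs : index_pairs n qs -> borel_closure n ps = borel_closure n qs ->
    I = borel_span K (gens qs).
  by move=> gqs E; rewrite IE psE !borel_spanE // E.
have not_principal p : index_pairs n [:: p] ->
  borel_closure n ps <> borel_closure n [:: p].
  by move=> gp /(spanE _ gp)/minI; rewrite /=; lia.
rewrite IE psE => /(freiman_borel_span K gps ps0)[a [an [|[[b ab CE]|[a3 CE]]]]].
- by move/not_principal; case; rewrite /index_pairs /=; lia.
- have gqs : index_pairs n [:: (1, a); (2, b)] by rewrite /index_pairs /=; lia.
  have [bE|b_a] := eqVneq b a; last first.
    left; exists a, b; split; [lia|lia|lia|].
    by rewrite -psE -IE (spanE _ gqs CE).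
  subst b; have g2 : index_pairs n [:: (2, a)] by rewrite /index_pairs /=; lia.
  case: (not_principal (2, a) g2); rewrite CE.
  by rewrite !(@borel_closure_two_rows _ _ a a) //=; lia.
have gqs : index_pairs n [:: (1, a); (3, 3)] by rewrite /index_pairs /=; lia.
have [aE|a_3] := eqVneq a 3; last first.
  right; exists a; split; [lia|lia|].
  by rewrite -psE -IE x3E (spanE _ gqs CE).
subst a; have g3 : index_pairs n [:: (3, 3)] by rewrite /index_pairs /=; lia.
case: (not_principal (3, 3) g3); rewrite CE.
by rewrite !(@borel_closure_three_rows _ _ 3) //=; lia.
Qed.
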